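(* There exist universal constants $C,\widetilde{C}>0$ such that the following holds. Let $(\Omega,\mu)$ be a probability space and let $\mathcal{B}=(b_j)_{j\in I}$ be a bounded orthonormal system with constant $K$ on it. Let $\mathcal{F}$ be a quasi-normed space of functions on $\Omega$ which compactly embeds into $L^\infty(\Omega)$. Let $\kappa,n\in\mathbb{N}$ and let $J,J^\ast\subset I$ be finite sets, $J^\ast$ nonempty, such that there exists a $(\kappa,n,J,J^\ast,\tau)$ quasi-projection $P:L^\infty(\Omega)\to L^\infty(\Omega)$ with $\tau=\|P\|_{L^\infty(\Omega)\to L^\infty(\Omega)}$, and put $N:=|J^\ast|$. Then $$\varrho_{\lceil CK^2\kappa\log(\kappa+1)^3\,n\log(n+1)^3\log(N+1)\rceil}(\mathcal{F})_{L^2(\mu)}\le\widetilde{C}\Big(\|P\|_{L^\infty(\Omega)\to L^\infty(\Omega)}\cdot\sigma_n(\mathcal{F};\mathcal{B})_{L^\infty(\Omega)}+\big(1+\|P\|_{L^\infty(\Omega)\to L^\infty(\Omega)}\big)\cdot E_J(\mathcal{F};\mathcal{B})_{L^\infty(\Omega)}\Big).$$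
   Context: $L^\infty(\Omega)$ denotes the space of all bounded measurable functions $f:\Omega\to\mathbb{C}$ (no identification of functions agreeing $\mu$-a.e.) with norm $\|f\|_{L^\infty(\Omega)}=\sup_{x\in\Omega}|f(x)|$. A bounded orthonormal system with constant $K$ is a family $\mathcal{B}=(b_j)_{j\in I}\subset L^\infty(\Omega)$ that is orthonormal in $L^2(\mu)$ and satisfies $\|b_j\|_{L^\infty(\Omega)}\le K$ for all $j\in I$. $\log$ is the natural logarithm. For $n\in\mathbb{N}$, $\Sigma_n=\{\sum_{j\in J}c_jb_j: J\subset I,\ |J|\le n,\ (c_j)_{j\in J}\in\mathbb{C}^J\}$; for $J\subset I$, $V_J=\mathrm{span}\{b_j:j\in J\}$. For a quasi-normed function space $\mathcal{F}$ embedded into $L^\infty(\Omega)$, $$\sigma_n(\mathcal{F};\mathcal{B})_{L^\infty(\Omega)}=\sup_{\|f\|_{\mathcal{F}}\le1}\ \inf_{g\in\Sigma_n}\|f-g\|_{L^\infty(\Omega)},\qquad E_J(\mathcal{F};\mathcal{B})_{L^\infty(\Omega)}=\sup_{\|f\|_{\mathcal{F}}\le1}\ \inf_{g\in V_J}\|f-g\|_{L^\infty(\Omega)}.$$ A $(\kappa,n,J,J^\ast,\tau)$ quasi-projection ($\tau>0$) is a linear operator $P:L^\infty(\Omega)\to L^\infty(\Omega)$ with: (i) $P(\Sigma_n)\subset\Sigma_{\kappa n}$; (ii) $Pf=f$ for all $f\in V_J$; (iii) $Pf\in V_{J^\ast}$ for all $f\in L^\infty(\Omega)$; (iv) $P$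 is bounded with $\|P\|_{L^\infty(\Omega)\to L^\infty(\Omega)}\le\tau$. The (nonlinear) sampling numbers are $\varrho_m(\mathcal{F})_X=\inf_{t_1,\ldots,t_m\in\Omega}\ \inf_{R:\mathbb{C}^m\to X}\ \sup_{\|f\|_{\mathcal{F}}\le1}\|f-R(f(t_1),\ldots,f(t_m))\|_X$, where $R$ ranges over all (not necessarily linear) maps. *)

(* Defs.v *)
From HB Require Import structures.
From mathcomp Require Import all_boot all_order all_algebra finmap.
From mathcomp.real_closed Require Import complex.
From mathcomp Require Import all_classical all_reals all_analysis.
From mathcomp Require Import measurable_realfun.

Set Implicit Arguments.
Unset Strict Implicit.
Unset Printing Implicit Defensive.

Import Order.TTheory GRing.Theory Num.Theory.
Import numFieldNormedType.Exports.

Local Open Scope classical_set_scope.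
Local Open Scope ring_scope.

Definition cmod (R : realType) (z : R[i]) : R := ComplexField.Normc.normc z.

Definition cmeasurable (R : realType) d (T : measurableType d)
    (f : T -> R[i]) : Prop :=
  measurable_fun setT (fun x => complex.Re (f x)) /\
  measurable_fun setT (fun x => complex.Im (f x)).

Definition cintegral (R : realType) d (T : measurableType d)
    (mu : {measure set T -> \bar R}) (f : T -> R[i]) : R[i] :=
  Complex (Rintegral mu setT (fun x => complex.Re (f x)))
          (Rintegral mu setT (fun x => complex.Im (f x))).

Definition L2norm (R : realType) d (T : measurableType d)
    (mu : {measure set T -> \bar R}) (f : T -> R[i]) : \bar R :=
  Lnorm mu 2%:E (fun x => (cmod (f x))%:E).

Definition in_L2 (R : realType) d (T : measurableType d)
    (mu : {measure set T -> \bar R}) (f : T -> R[i]) : Prop :=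
  cmeasurable f /\ (L2norm mu f < +oo)%E.

(* Genuine functions, not classes modulo almost everywhere equality. *)
Section Linf.
Context (R : realType) d (T : measurableType d).

Definition Linf_pred : {pred T -> R[i]} :=
  mem [set f | cmeasurable f /\ exists M : R, forall x, cmod (f x) <= M].

Lemma Linf_submod_closed : submod_closed Linf_pred.
Proof.
split.
  rewrite inE; split; first by split; exact: measurable_cst.
  by exists 0 => x; rewrite /cmod ComplexField.Normc.normc0.
move=> a f g; rewrite !inE => -[[fr fi] [Mf fM]] [[gr gi] [Mg gM]].
have E x : (a *: f + g) x = a * f x + g x by [].
split; last first.
  exists (cmod a * Mf + Mg) => x; rewrite E.
  apply: (le_trans (le_normcD (a * f x : Rcomplex R) (g x))).
  rewrite lerD //; last exact: gM.
  rewrite ComplexField.Normc.normcM ler_wpM2l //; last exact: fM.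
  by case: (a) => u v /=; rewrite sqrtr_ge0.
split.
  rewrite (_ : (fun _ => _) = (fun x =>
      complex.Re a * complex.Re (f x) - complex.Im a * complex.Im (f x)
      + complex.Re (g x))); last first.
    by apply/funext => x; rewrite E; case: (a) (f x) (g x) => ? ? [? ?] [? ?].
  apply: measurable_funD => //; apply: measurable_funB;
    by apply: measurable_funM => //; exact: measurable_cst.
rewrite (_ : (fun _ => _) = (fun x =>
    complex.Re a * complex.Im (f x) + complex.Im a * complex.Re (f x)
    + complex.Im (g x))); last first.
  by apply/funext => x; rewrite E; case: (a) (f x) (g x) => ? ? [? ?] [? ?].
apply: measurable_funD => //; apply: measurable_funD;
  by apply: measurable_funM => //; exact: measurable_cst.
Qed.

HB.instance Definition _ :=
  GRing.isSubmodClosed.Build R[i] (T -> R[i]) Linf_pred Linf_submod_closed.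

Record Linf := MkLinf { Linf_fun :> T -> R[i]; _ : Linf_fun \in Linf_pred }.

HB.instance Definition _ := [isSub for Linf_fun].
HB.instance Definition _ := [Choice of Linf by <:].
HB.instance Definition _ := [SubChoice_isSubLmodule of Linf by <:].

End Linf.

Section Approximation.
Context (R : realType) d (T : measurableType d).
Local Notation Linf := (Linf R T).

Definition sup_norm (f : Linf) : \bar R :=
  ereal_sup (range (fun x => (cmod (f x))%:E)).

Definition op_norm (P : Linf -> Linf) : \bar R :=
  ereal_sup [set sup_norm (P f) | f in [set f | (sup_norm f <= 1)%E]].

Definition bounded_orthonormal_system (mu : probability T R) (I : choiceType)
    (K : R) (b : I -> Linf) : Prop :=
  (forall i j,
     cintegral mu (fun x => b i x * conjc (b j x)) = (i == j)%:R) /\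
  (forall j, (sup_norm (b j) <= K%:E)%E).

Definition lin_span (I : choiceType) (b : I -> Linf) (J : {fset I}) :
    set Linf :=
  [set \sum_(j <- J) c j *: b j | c in [set: I -> R[i]]].

Definition Sigma (I : choiceType) (b : I -> Linf) (n : nat) : set Linf :=
  [set g | exists2 J : {fset I}, (#|` J| <= n)%N & lin_span b J g].

Definition quasi_projection (I : choiceType) (b : I -> Linf)
    (kappa n : nat) (J Jstar : {fset I}) (tau : R)
    (P : {linear Linf -> Linf}) : Prop :=
  [/\ 0 < tau,
      forall f, Sigma b n f -> Sigma b (kappa * n) (P f),
      forall f, lin_span b J f -> P f = f,
      forall f, lin_span b Jstar (P f)
    & (op_norm P <= tau%:E)%E].

(* The values of [q] outside [F] are irrelevant. *)
Record quasi_normed_space (F : {pred Linf}) (q : Linf -> R) : Prop := {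
  qns_submod : submod_closed F ;
  qns_ge0 : forall f, f \in F -> 0 <= q f ;
  qns_eq0 : forall f, f \in F -> q f = 0 -> f = 0 ;
  qns_hom : forall (a : R[i]) f, f \in F -> q (a *: f) = cmod a * q f ;
  qns_triangle : exists c : R, forall f g, f \in F -> g \in F ->
    q (f + g) <= c * (q f + q g) }.

Definition unit_ball (F : {pred Linf}) (q : Linf -> R) : set Linf :=
  [set f | f \in F /\ q f <= 1].

(* Since [Linf] is closed in the space of all functions with the topology of
   uniform convergence, relative compactness can be taken in the latter.
   The cast to [numFieldType] provides the topology of [R[i]]. *)
Definition compactly_embedded (F : {pred Linf}) (q : Linf -> R) : Prop :=
  precompact ([set (f : T -> R[i]) | f in unit_ball F q]
    : set {uniform T -> (R[i] : numFieldType)}).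

Definition worst_case_error (F : {pred Linf}) (q : Linf -> R)
    (G : set Linf) : \bar R :=
  ereal_sup [set ereal_inf [set sup_norm (f - g) | g in G]
            | f in unit_ball F q].

Definition best_nterm_width (I : choiceType) (b : I -> Linf)
    (F : {pred Linf}) (q : Linf -> R) (n : nat) : \bar R :=
  worst_case_error F q (Sigma b n).

Definition best_linear_width (I : choiceType) (b : I -> Linf)
    (F : {pred Linf}) (q : Linf -> R) (J : {fset I}) : \bar R :=
  worst_case_error F q (lin_span b J).

Definition sampling_number_L2 (mu : probability T R)
    (F : {pred Linf}) (q : Linf -> R) (m : nat) : \bar R :=
  ereal_inf [set
    ereal_inf [set
      ereal_sup [set L2norm mu (fun x => f x - rec (\row_i f (t i)) x)
                | f in unit_ball F q]
      | rec in [set rec : 'rV[R[i]]_m -> T -> R[i] |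
                  forall y, in_L2 mu (rec y)]]
    | t in [set: 'I_m -> T]].

End Approximation.

(* Main.v *)
(* An f in the unit ball is uniformly delta-close to some P g with g in
   Sigma_n, where P g is kappa n-sparse and lies in the finite-dimensional space
   V_{J*}.  The recovery map returns any sparse element of V_{J*} matching the
   data up to delta, so everything reduces to finding nodes t_1, ..., t_m with
   |u|_{L2} <= 16 max_i |u(t_i)| for all 2 kappa n-sparse u in V_{J*}; no
   two-sided restricted isometry is needed.

   By a finite quadrature mu is replaced by finitely many weighted points.
   Normalise |u|_2 = 1 and let S bound the sparsity.  Either u has substantial
   mass where |u| <= K, or mu(|u|^2 > K^2 4^j) >= c / (K^2 4^j log S) for one of
   the O(log S) levels j with 4^j <= S.  Maurey's empirical method approximates u
   by averages of q atoms, which form a finite net.  In the first case q ~ S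
   suffices for an L2 approximation.  At level j one takes q ~ S 4^-j and boosts
   the success probability by a majority vote among O(log S) independent
   averages.  The approximation is only required at most points, for mu and for
   the sample, and its failure set is controlled by the L2 norms of the b_j; so
   neither log K nor log log N enters.  For each finite net, averaging an
   exponential potential over i.i.d. samples gives nodes at which all tests of
   the net succeed proportionally often.  Concatenating the nodes of all levels
   costs the third logarithm of S. *)
Require Import Defs.
From HB Require Import structures.
From mathcomp Require Import all_boot all_order all_algebra finmap.
From mathcomp.real_closed Require Import complex.
From mathcomp Require Import all_classical all_reals all_analysis.
From mathcomp Require Import measurable_realfun ring lra zify.

Set Implicit Arguments.
Unset Strict Implicit.
Unset Printing Implicit Defensive.

Import Order.TTheory GRing.Theory Num.Theory.
Import numFieldNormedType.Exports.

Local Open Scope classical_set_scope.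
Local Open Scope ring_scope.

(** * Mean functionals and their iterates *)

Section Means.
Context (R : realType).

(** Expectation is encoded as a normalised positive linear functional on all functions, which keeps
    measurability out of the probabilistic arguments; the instances below are all finite weighted
    sums. *)
Definition mean_functional (Y : Type) (E : (Y -> R) -> R) : Prop :=
  [/\ forall a F G, E (fun y => a * F y + G y) = a * E F + E G,
      forall F, (forall y, 0 <= F y) -> 0 <= E F
    & E (fun=> 1) = 1].

Section Theory.
Context (Y : Type) (E : (Y -> R) -> R).
Hypothesis meanE : mean_functional E.

Lemma mean0 : E (fun=> 0) = 0.
Proof.
case: meanE => lin _ _; have := lin (-1) (fun=> 0) (fun=> 0).
rewrite (_ : (fun=> -1 * 0 + 0) = (fun=> 0)); last by apply/funext => y; ring.
by move=> ->; ring.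
Qed.

Lemma meanZ a F : E (fun y => a * F y) = a * E F.
Proof.
case: meanE => lin _ _; have := lin a F (fun=> 0); rewrite mean0 addr0 => <-.
by congr E; apply/funext => y; rewrite addr0.
Qed.

Lemma meanD F G : E (fun y => F y + G y) = E F + E G.
Proof.
case: meanE => lin _ _; have := lin 1 F G; rewrite mul1r => <-.
by congr E; apply/funext => y; rewrite mul1r.
Qed.

Lemma mean_cst a : E (fun=> a) = a.
Proof.
case: meanE => _ _ E1; rewrite -[RHS]mulr1 -E1 -meanZ.
by congr E; apply/funext => y; rewrite mulr1.
Qed.

Lemma mean_sum (J : Type) (r : seq J) (P : pred J) (F : J -> Y -> R) :
  E (fun y => \sum_(j <- r | P j) F j y) = \sum_(j <- r | P j) E (F j).
Proof.
elim: r => [|j r IH].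
  by rewrite big_nil -[RHS]mean0; congr E; apply/funext => y; rewrite big_nil.
rewrite big_cons -IH; case: ifP => Pj.
  by rewrite -meanD; congr E; apply/funext => y; rewrite big_cons Pj.
by congr E; apply/funext => y; rewrite big_cons Pj.
Qed.

Lemma mean_le F G : (forall y, F y <= G y) -> E F <= E G.
Proof.
move=> FG; case: meanE => lin pos _; rewrite -subr_ge0.
suff -> : E G - E F = E (fun y => -1 * F y + G y).
  by apply: pos => y; have := FG y; lra.
by rewrite lin; ring.
Qed.

Lemma mean_lt_ex F c : E F < c -> exists y, F y < c.
Proof.
move=> Fc; apply: contrapT => /forallNP Fgt.
suff : c <= E F by rewrite leNgt Fc.
by rewrite -[leLHS]mean_cst; apply: mean_le => y; rewrite leNgt; apply/negP/Fgt.
Qed.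

End Theory.

(** The expectation over words of [q] independent draws from [E]. *)
Fixpoint iterE (Y : Type) (E : (Y -> R) -> R) (q : nat) (F : seq Y -> R) : R :=
  if q is q'.+1 then E (fun y => iterE E q' (fun s => F (y :: s)))
  else F [::].

Section IterTheory.
Context (Y : Type) (E : (Y -> R) -> R).
Hypothesis meanE : mean_functional E.

Lemma iterE_mean q : mean_functional (iterE E q).
Proof.
elim: q => [|q [lin pos one]]; first by split=> /= [||] // F; exact.
split=> /=.
- move=> a F G; have [linE _ _] := meanE; rewrite -linE.
  by congr E; apply/funext => y; rewrite -lin.
- by move=> F F0; have [_ posE _] := meanE; apply: posE => y; exact: pos.
- rewrite -[RHS](mean_cst meanE 1); congr E; apply/funext => y.
  exact: one.
Qed.

Lemma iterE_le q F G : (forall s, size s = q -> F s <= G s) ->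
  iterE E q F <= iterE E q G.
Proof.
elim: q F G => [|q IH] F G FG /=; first exact: FG.
apply: mean_le => // y; apply: IH => s sq.
by apply: FG; rewrite /= sq.
Qed.

Lemma iterE_prod q (phi : Y -> R) :
  iterE E q (fun s => \prod_(y <- s) phi y) = E phi ^+ q.
Proof.
elim: q => [|q IH] /=; first by rewrite big_nil expr0.
rewrite exprS -IH mulrC -meanZ //; congr E; apply/funext => y.
rewrite mulrC -(meanZ (iterE_mean q)); congr iterE; apply/funext => s.
by rewrite big_cons.
Qed.

(** First-moment method. The predicate [Q] survives into the conclusion so that the lemma applies to
    an iterate of an iterate, where [Q] records the length of the inner words. *)
Lemma iterE_lt_ex (Q : pred Y) :
  (forall F c, E F < c -> exists2 y, Q y & F y < c) ->
  forall q F c, iterE E q F < c ->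
    exists s, [/\ size s = q, all Q s & F s < c].
Proof.
move=> EQ; elim=> [|q IH] F c /=; first by move=> Fc; exists [::].
move=> /EQ[y Qy] /IH[s [sq Qs Fs]]; exists (y :: s); split => //=.
  by rewrite sq.
by rewrite Qy.
Qed.

(** Variances of independent centred draws add up, because the cross terms vanish. The offset [y]
    lets the induction absorb the first draw. *)
Lemma iterE_sqr q (Z : Y -> R) y : E Z = 0 ->
  iterE E q (fun s => (y + \sum_(d <- s) Z d) ^+ 2) =
  y ^+ 2 + q%:R * E (fun d => Z d ^+ 2).
Proof.
move=> EZ; elim: q y => [|q IH] y /=; first by rewrite big_nil; ring.
rewrite (_ : (fun d => _) = (fun d => (2 * y) * Z d +
   (Z d ^+ 2 + (y ^+ 2 + q%:R * E (fun d => Z d ^+ 2))))); last first.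
  apply/funext => d; rewrite (_ : (fun s => _) =
    (fun s => ((y + Z d) + \sum_(d <- s) Z d) ^+ 2)); last first.
    by apply/funext => s; rewrite big_cons addrA.
  by rewrite IH; ring.
rewrite meanD // meanZ // EZ mulr0 add0r meanD // mean_cst //.
by rewrite -natr1; ring.
Qed.

(** The union bound over the at most 2^n sets of bad positions, obtained by a recursion of Pascal
    type on whether the first draw is bad. *)
Lemma iterE_count_le (bad : pred Y) (delta : R) n a :
  E (fun y => (bad y)%:R) <= delta -> 0 <= delta ->
  iterE E n (fun s => (a <= count bad s)%N%:R) <= 2 ^+ n * delta ^+ a.
Proof.
move=> badd d0; elim: n a => [|n IH] a /=.
  by case: a => [|a]; rewrite ?expr0 ?mulr1 //= mul1r exprn_ge0.
case: a => [|a].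
  rewrite expr0 mulr1; apply: (@le_trans _ _ 1).
    rewrite -[leRHS](mean_cst meanE); apply: mean_le => // y.
    rewrite -[leRHS](mean_cst (iterE_mean n)).
    by apply: mean_le => //; exact: iterE_mean.
  by rewrite exprn_ege1 // ler1n.
have En := iterE_mean n.
set A := iterE E n (fun s => (a <= count bad s)%N%:R).
set B := iterE E n (fun s => (a.+1 <= count bad s)%N%:R).
apply: (@le_trans _ _ (A * delta + B)).
  apply: (@le_trans _ _ (E (fun y => A * (bad y)%:R + B))).
    apply: mean_le => // y; rewrite mulrC -(meanZ En) -(meanD En).
    apply: mean_le => // s /=; case: (bad y) => /=; last by rewrite mul0r add0r.
    by rewrite add1n ltnS mul1r lerDl.
  rewrite meanD // meanZ // mean_cst // lerD2r ler_wpM2l //.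
  by have [_ pos _] := En; apply: pos => s.
have := IH a.+1; have := IH a; rewrite -/A -/B => hA hB.
have hAd : A * delta <= 2 ^+ n * delta ^+ a * delta by rewrite ler_wpM2r.
rewrite (_ : 2 ^+ n.+1 * delta ^+ a.+1 =
  2 ^+ n * delta ^+ a * delta + 2 ^+ n * delta ^+ a.+1); first exact: lerD.
by rewrite !exprS; ring.
Qed.

End IterTheory.

(** * Finitely supported measures *)

Section FiniteSums.
Context (X : Type).
Implicit Types nu : seq (R * X).

(** The total mass need not be 1, so concatenating two lists adds the functionals; this controls the
    quadrature [pts] and a sample at once. *)
Definition fsum nu (F : X -> R) : R := \sum_(z <- nu) z.1 * F z.2.

Definition nonneg_weights nu := all (fun z => 0 <= z.1) nu.

Lemma fsum_cat nu nu' F : fsum (nu ++ nu') F = fsum nu F + fsum nu' F.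
Proof. by rewrite /fsum big_cat. Qed.

Lemma fsum_lin nu a F G :
  fsum nu (fun x => a * F x + G x) = a * fsum nu F + fsum nu G.
Proof.
rewrite /fsum mulr_sumr -big_split; apply: eq_bigr => z _ /=; ring.
Qed.

Lemma fsum_ge0 nu F : nonneg_weights nu -> (forall x, 0 <= F x) ->
  0 <= fsum nu F.
Proof.
rewrite /fsum; elim: nu => [|z nu IH] /=; first by rewrite big_nil.
by move=> /andP[z0 nu0] F0; rewrite big_cons addr_ge0 ?mulr_ge0 ?IH.
Qed.

Lemma fsum_le nu F G : nonneg_weights nu -> (forall x, F x <= G x) ->
  fsum nu F <= fsum nu G.
Proof.
move=> nu0 FG; rewrite -subr_ge0.
suff -> : fsum nu G - fsum nu F = fsum nu (fun x => -1 * F x + G x).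
  by apply: fsum_ge0 => // x; have := FG x; lra.
by rewrite fsum_lin; ring.
Qed.

Lemma fsumZ nu a F : fsum nu (fun x => a * F x) = a * fsum nu F.
Proof. by rewrite /fsum mulr_sumr; apply: eq_bigr => z _; ring. Qed.

Lemma fsumD nu F G : fsum nu (fun x => F x + G x) = fsum nu F + fsum nu G.
Proof. by rewrite /fsum -big_split; apply: eq_bigr => z _ /=; ring. Qed.

Lemma fsum_sum nu (J : Type) (r : seq J) (P : pred J) (F : J -> X -> R) :
  fsum nu (fun x => \sum_(j <- r | P j) F j x) =
  \sum_(j <- r | P j) fsum nu (F j).
Proof.
by rewrite /fsum exchange_big; apply: eq_bigr => z _ /=; rewrite mulr_sumr.
Qed.

Lemma mean_fsum (Y : Type) (E : (Y -> R) -> R) nu (F : Y -> X -> R) :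
  mean_functional E ->
  E (fun y => fsum nu (F y)) = fsum nu (fun x => E (F ^~ x)).
Proof.
move=> meanE; rewrite /fsum mean_sum //; apply: eq_bigr => z _.
by rewrite meanZ.
Qed.

Lemma fsum_mean nu : nonneg_weights nu -> fsum nu (fun=> 1) = 1 ->
  mean_functional (fsum nu).
Proof.
move=> nu0 nu1; split=> //; first exact: fsum_lin.
by move=> F; exact: fsum_ge0.
Qed.

Definition empirical (t : seq X) : seq (R * X) :=
  [seq ((size t)%:R^-1, x) | x <- t].

Lemma fsum_empirical t F :
  fsum (empirical t) F = (size t)%:R^-1 * \sum_(x <- t) F x.
Proof. by rewrite /fsum /empirical big_map mulr_sumr. Qed.

Lemma empirical_ge0 t : nonneg_weights (empirical t).
Proof.
rewrite /nonneg_weights /empirical all_map (@eq_all _ _ xpredT) ?all_predT //.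
by move=> x /=; rewrite invr_ge0 ler0n.
Qed.

End FiniteSums.

End Means.

(** Enumerates the finite nets: an average of [q] atoms is determined by a word over the atoms, and
    only the logarithm of the number of words enters the node count. *)
Fixpoint words (Y : Type) (A : seq Y) (q : nat) : seq (seq Y) :=
  if q is q'.+1 then [seq y :: s | y <- A, s <- words A q'] else [:: [::]].

Lemma size_words (Y : Type) (A : seq Y) q : size (words A q) = (size A ^ q)%N.
Proof. by elim: q => //= q IH; rewrite size_allpairs IH expnS. Qed.

Lemma mem_words (Y : eqType) (A : seq Y) q s :
  size s = q -> all (mem A) s -> s \in words A q.
Proof.
elim: q s => [|q IH] [|y s] //= [sq] /andP[yA sA].
by apply/allpairsP; exists (y, s); split=> //=; exact: IH.
Qed.

(** * Nodes for a finite family of tests *)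

Section Sampling.
Context (R : realType).

Lemma expR_opp_le1B (y : R) : 0 <= y <= 1 -> expR (- y) <= 1 - y / 2.
Proof.
move=> /andP[y0 y1]; rewrite expRN -ler_pV2 ?inE ?unitfE ?gt_eqF ?invrK //=;
  rewrite ?invr_gt0 ?expR_gt0 //; try lra.
apply: le_trans (expR_ge1Dx y); rewrite -div1r ler_pdivrMr; nra.
Qed.

Lemma expR_le1D (y : R) : 0 <= y <= 1 -> expR (y / 2) <= 1 + y.
Proof.
move=> /andP[y0 y1]; have h := expR_ge1Dx (- (y / 2)).
have e : expR (y / 2) * expR (- (y / 2)) = 1 by rewrite -expRD subrr expR0.
have e0 := expR_gt0 (y / 2); nra.
Qed.

Lemma size_sum_cst (X : Type) (t : seq X) (a : R) :
  \sum_(x <- t) a = (size t)%:R * a.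
Proof. by rewrite big_const_seq count_predT iter_addr_0 mulr_natl. Qed.

Lemma prod_ge_expR (X : Type) (t : seq X) (phi f : X -> R) :
  (forall x, expR (f x) <= phi x) ->
  expR (\sum_(x <- t) f x) <= \prod_(x <- t) phi x.
Proof.
move=> h; elim: t => [|x t IH]; first by rewrite !big_nil expR0.
by rewrite !big_cons expRD ler_pM ?expR_ge0.
Qed.

(* The points are found by averaging, over i.i.d. samples, the sum over all
   tests of exponential weights that become large when the test fails. *)
Lemma sampling_points (X : Type) (E : (X -> R) -> R) (G V : eqType)
    (net : seq G) (psi : G -> X -> R) (VV : seq V) (chi : V -> X -> R)
    (theta eta : R) (m : nat) :
  mean_functional E ->
  (forall g x, 0 <= psi g x <= 1) -> (forall k x, 0 <= chi k x <= 1) ->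
  (forall k, E (chi k) <= eta) ->
  let M := ln (size net + size VV).+1%:R in
  4 * M <= m%:R * theta -> M <= m%:R * eta ->
  exists t : seq X, [/\ size t = m,
    forall g, g \in net -> theta <= E (psi g) ->
      m%:R * theta / 4 <= \sum_(x <- t) psi g x
  & forall k, k \in VV -> \sum_(x <- t) chi k x <= 4 * m%:R * eta].
Proof.
move=> meanE psi01 chi01 chieta M hM1 hM2.
pose good g := theta <= E (psi g).
(* [phi] and [omega] are affine majorants of exp(theta/2 - psi) and exp(chi/2 - eta) on [0, 1].
   Their means are at most 1, for good [g] and for every [k] respectively. *)
pose phi g x := expR (theta / 2) * (1 - psi g x / 2).
pose omega k x := expR (- eta) * (1 + chi k x).
pose pot (t : seq X) := \sum_(g <- net | good g) \prod_(x <- t) phi g x +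
  \sum_(k <- VV) \prod_(x <- t) omega k x.
have phi0 g x : 0 <= phi g x.
  rewrite mulr_ge0 ?expR_ge0 //; have := psi01 g x; lra.
have omega0 k x : 0 <= omega k x.
  rewrite mulr_ge0 ?expR_ge0 //; have := chi01 k x; lra.
have Ephi g : good g -> 0 <= E (phi g) <= 1.
  move=> gg; have [lin pos _] := meanE; rewrite pos //= /phi meanZ //.
  rewrite (_ : (fun x => 1 - _) = (fun x => (- 2^-1) * psi g x + 1)); last first.
    by apply/funext => x; rewrite addrC mulNr mulrC.
  rewrite lin mean_cst //; apply: (@le_trans _ _
    (expR (theta / 2) * expR (- (theta / 2)))); last first.
    by rewrite -expRD subrr expR0.
  rewrite ler_wpM2l ?expR_ge0 //; apply: le_trans (expR_ge1Dx _).
  move: gg; rewrite /good; lra.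
have Eomega k : 0 <= E (omega k) <= 1.
  have [lin pos _] := meanE; rewrite pos //= /omega meanZ //.
  rewrite meanD // mean_cst //; apply: (@le_trans _ _
    (expR (- eta) * expR eta)); last first.
    by rewrite -expRD addNr expR0.
  rewrite ler_wpM2l ?expR_ge0 //; apply: le_trans (expR_ge1Dx _).
  by rewrite lerD2l.
have Em := iterE_mean meanE m.
(* Each term has mean at most 1; the successor makes the bound strict, as the first-moment argument
   needs. *)
have Epot : iterE E m pot < (size net + size VV).+1%:R.
  rewrite /pot meanD // !mean_sum //.
  apply: (@le_lt_trans _ _ ((size net)%:R + (size VV)%:R)); last first.
    by rewrite -natrD ltr_nat.
  apply: lerD.
    rewrite big_mkcond -[leRHS]mulr1 -size_sum_cst; apply: ler_sum => g _.
    case: ifP => // gg; rewrite iterE_prod //; have /andP[? ?] := Ephi g gg.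
    exact: exprn_ile1.
  rewrite -[leRHS]mulr1 -size_sum_cst; apply: ler_sum => k _.
  rewrite iterE_prod //; have /andP[? ?] := Eomega k.
  exact: exprn_ile1.
have [] := @iterE_lt_ex _ _ _ xpredT _ m _ _ Epot.
  by move=> F c /(mean_lt_ex meanE)[y]; exists y.
move=> t [tm _ pott]; exists t; split => // [g gnet gg|k kVV].
  have : \prod_(x <- t) phi g x < (size net + size VV).+1%:R.
    apply: le_lt_trans pott; rewrite /pot (big_rem g) //= -/(good g).
    have -> : good g by [].
    rewrite -addrA lerDl addr_ge0 // sumr_ge0 // => *; exact: prodr_ge0.
  have : expR (\sum_(x <- t) (theta / 2 - psi g x)) <= \prod_(x <- t) phi g x.
    apply: prod_ge_expR => x; rewrite expRD ler_wpM2l ?expR_ge0 //.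
    exact: expR_opp_le1B.
  (* Taking logarithms, m theta / 2 minus the sum of [psi g] is below M, which is at most m theta /
     4. *)
  move=> /le_lt_trans h /h; rewrite -ltr_ln ?posrE ?expR_gt0 ?ltr0n // expRK -/M.
  rewrite sumrB size_sum_cst tm; lra.
have : \prod_(x <- t) omega k x < (size net + size VV).+1%:R.
  apply: le_lt_trans pott; rewrite /pot [X in _ + X](big_rem k) //=.
  rewrite addrCA lerDl addr_ge0 // sumr_ge0 // => *; exact: prodr_ge0.
have : expR (\sum_(x <- t) (chi k x / 2 - eta)) <= \prod_(x <- t) omega k x.
  apply: prod_ge_expR => x; rewrite addrC expRD ler_wpM2l ?expR_ge0 //.
  exact: expR_le1D.
move=> /le_lt_trans h /h; rewrite -ltr_ln ?posrE ?expR_gt0 ?ltr0n // expRK -/M.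
rewrite sumrB size_sum_cst tm -mulr_suml; lra.
Qed.
End Sampling.

(** * Maurey's empirical method *)

Section Dictionary.
Context (R : realType) (V : finType) (X : Type) (h : V -> X -> bool -> R).

(** The boolean indexes the two real coordinates of a complex value, so this is the squared
    modulus. *)
Definition sqn (z : bool -> R) : R := z true ^+ 2 + z false ^+ 2.

Lemma sqn_ge0 z : 0 <= sqn z.
Proof. by rewrite addr_ge0 ?sqr_ge0. Qed.

Lemma sqn_le2 z w : sqn z <= 2 * sqn w + 2 * sqn (fun e => w e - z e).
Proof.
have := sqr_ge0 (2 * w true - z true); have := sqr_ge0 (2 * w false - z false).
by rewrite /sqn; lra.
Qed.

Lemma sqnC z w : sqn (fun e => w e - z e) = sqn (fun e => z e - w e).
Proof. by rewrite /sqn; ring. Qed.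

Definition synth (v : V -> R) (x : X) (e : bool) : R :=
  \sum_k v k * h k x e.

(* [None] is the zero atom; it absorbs the missing mass of a coefficient
   vector whose l1 norm is smaller than the scale [rho]. *)
Definition atom (d : option (V * bool)) (x : X) (e : bool) : R :=
  if d is Some (k, sg) then (-1) ^+ sg * h k x e else 0.

Definition atoms : seq (option (V * bool)) := enum {: option (V * bool)}.

Lemma size_atoms : size atoms = (2 * #|V|).+1.
Proof. by rewrite -cardE card_option card_prod card_bool mulnC. Qed.

Definition avg_atoms (rho : R) (q : nat) (s : seq (option (V * bool)))
    (x : X) (e : bool) : R :=
  rho / q%:R * \sum_(d <- s) atom d x e.

(** The law of Maurey's random atom, arranged so that [rho] times the atom has expectation
    [synth h v]. *)
Definition maurey_mean (rho : R) (v : V -> R)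
    (F : option (V * bool) -> R) : R :=
  \sum_k `|v k| / rho * F (Some (k, v k < 0)) +
  (1 - \sum_k `|v k| / rho) * F None.

Section Maurey.
Variables (rho : R) (v : V -> R).
Hypothesis rho_gt0 : 0 < rho.
Hypothesis v_rho : \sum_k `|v k| <= rho.

(** The second moment of the random atom. It is kept as a function of [x], because its mean is
    controlled by the L2 norms of the dictionary and can be far below the pointwise bound. *)
Definition spread (x : X) : R := \sum_k `|v k| / rho * sqn (h k x).

Lemma spread_ge0 x : 0 <= spread x.
Proof.
apply: sumr_ge0 => k _.
by rewrite mulr_ge0 ?sqn_ge0 ?divr_ge0 // ltW.
Qed.

Lemma sum_weights_le1 : \sum_k `|v k| / rho <= 1.
Proof. by rewrite -mulr_suml ler_pdivrMr // mul1r. Qed.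

Lemma maurey_mean_functional : mean_functional (maurey_mean rho v).
Proof.
split.
- move=> a F G; rewrite /maurey_mean.
  rewrite (eq_bigr (fun k => a * (`|v k| / rho * F (Some (k, v k < 0))) +
    `|v k| / rho * G (Some (k, v k < 0)))); last by move=> k _; ring.
  by rewrite big_split /= -mulr_sumr; ring.
- move=> F F0; rewrite addr_ge0 //.
    apply: sumr_ge0 => k _.
    by rewrite mulr_ge0 ?divr_ge0 // ltW.
  by rewrite mulr_ge0 // subr_ge0 sum_weights_le1.
- rewrite /maurey_mean (eq_bigr (fun k => `|v k| / rho)); first by ring.
  by move=> k _; rewrite mulr1.
Qed.

Lemma maurey_mean_atom x e :
  maurey_mean rho v (fun d => rho * atom d x e) = synth v x e.
Proof.
rewrite /maurey_mean /= !mulr0 addr0; apply: eq_bigr => k _.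
have rho0 : rho != 0 by rewrite gt_eqF.
case: ltP => vk /=; first by rewrite ltr0_norm // expr1; field.
by rewrite ger0_norm // expr0; field.
Qed.

Lemma maurey_mean_sqn x :
  maurey_mean rho v (fun d => sqn (atom d x)) = spread x.
Proof.
rewrite /maurey_mean /= {2}/sqn /= expr0n /= addr0 mulr0 addr0.
apply: eq_bigr => k _; congr (_ * _); rewrite /sqn /= !exprMn -!exprM.
by rewrite mulnC exprM sqrrN !expr1n !mul1r.
Qed.

(** The deviation is an average of [q] independent centred terms, so its variance is 1/q times that
    of one term, which is at most the second moment. *)
Lemma maurey_variance q x : (0 < q)%N ->
  iterE (maurey_mean rho v) q
    (fun s => sqn (fun e => avg_atoms rho q s x e - synth v x e)) <=
  rho ^+ 2 / q%:R * spread x.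
Proof.
move=> q0; have mm := maurey_mean_functional.
pose Z e d := rho * atom d x e - synth v x e.
have qR : q%:R != 0 :> R by rewrite pnatr_eq0 -lt0n.
have EZ e : maurey_mean rho v (Z e) = 0.
  have [lin _ _] := mm.
  rewrite (_ : Z e = fun d => 1 * (rho * atom d x e) + - synth v x e).
    by rewrite lin mean_cst // maurey_mean_atom; ring.
  by apply/funext => d; rewrite mul1r.
have EZ2 e : maurey_mean rho v (fun d => Z e d ^+ 2) <=
    rho ^+ 2 * maurey_mean rho v (fun d => atom d x e ^+ 2).
  rewrite (_ : (fun d => Z e d ^+ 2) = (fun d => (- (2 * synth v x e)) *
     (rho * atom d x e) + (rho ^+ 2 * atom d x e ^+ 2 + synth v x e ^+ 2))).
    have [lin _ _] := mm.
    rewrite lin maurey_mean_atom meanD // meanZ // mean_cst //.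
    by have := sqr_ge0 (synth v x e); nra.
  by apply/funext => d; rewrite /Z; ring.
apply: (@le_trans _ _ (iterE (maurey_mean rho v) q (fun s => q%:R ^- 2 *
   ((0 + \sum_(d <- s) Z true d) ^+ 2 + (0 + \sum_(d <- s) Z false d) ^+ 2)))).
  apply: iterE_le => // s sq; rewrite /sqn !add0r.
  have dev e : avg_atoms rho q s x e - synth v x e =
      q%:R^-1 * \sum_(d <- s) Z e d.
    rewrite /avg_atoms sumrB size_sum_cst sq -mulr_sumr.
    by field.
  by rewrite !dev !exprMn mulrDr exprVn.
have Em := iterE_mean mm q.
rewrite meanZ // meanD // !iterE_sqr // expr0n /= !add0r -mulrDr.
rewrite -maurey_mean_sqn /sqn meanD //.
rewrite (_ : rho ^+ 2 / _ * _ = q%:R ^- 2 * (q%:R * (rho ^+ 2 *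
  (maurey_mean rho v (fun d => atom d x true ^+ 2) +
   maurey_mean rho v (fun d => atom d x false ^+ 2))))); last by field.
rewrite ler_wpM2l ?invr_ge0 ?exprn_ge0 // ler_wpM2l //.
by rewrite mulrDr lerD.
Qed.

End Maurey.
End Dictionary.

(** * Nodes for one level *)

Section Core.
Context (R : realType).

Lemma mean_sqr_le (Y : Type) (E : (Y -> R) -> R) F : mean_functional E ->
  E F ^+ 2 <= E (fun y => F y ^+ 2).
Proof.
move=> mE; have [lin pos _] := mE.
have := pos (fun y => (F y - E F) ^+ 2) (fun y => sqr_ge0 _).
rewrite (_ : (fun y => _) =
  (fun y => - (2 * E F) * F y + (F y ^+ 2 + E F ^+ 2))).
  by rewrite lin meanD // mean_cst //; nra.
by apply/funext => y; ring.
Qed.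

Lemma ex_nat_ceil (x : R) : 0 <= x -> exists m : nat, x <= m%:R <= x + 1.
Proof.
move=> x0; exists (Num.truncn x).+1; have /andP[h1 h2] := truncn_itv x0.
by rewrite ltW //= -natr1 lerD2r.
Qed.

Lemma ln_nat_ge (n : nat) : (1 < n)%N -> 1 <= 2 * ln (n%:R : R).
Proof.
move=> n1; have n0 : (0 < n)%N by exact: ltnW.
have : expR (1 / 2) <= 1 + 1 :> R by apply: expR_le1D; rewrite ler01 lexx.
move=> /le_trans /(_ (_ : 1 + 1 <= n%:R)) h.
have : expR (1 / 2) <= n%:R :> R by apply: h; rewrite -(natrD _ 1 1) ler_nat.
rewrite -ler_ln ?posrE ?expR_gt0 ?ltr0n // expRK; lra.
Qed.

(** With D = 2 v + 1 >= 3, one additional power of D absorbs both [v] and the successor. *)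
Lemma ln_net_size (v n : nat) : (0 < v)%N -> (0 < n)%N ->
  ln ((2 * v).+1 ^ n + v).+1%:R <= n.+1%:R * ln ((2 * v).+1%:R : R).
Proof.
move=> v0 n0; rewrite mulr_natl -lnXn ?ltr0n // -natrX.
rewrite ler_ln ?posrE ?ltr0n ?expn_gt0 // ler_nat expnS.
have h : ((2 * v).+1 <= (2 * v).+1 ^ n)%N.
  by rewrite -[leqLHS]expn1 leq_pexp2l.
have : (3 * (2 * v).+1 ^ n <= (2 * v).+1 * (2 * v).+1 ^ n)%N.
  by rewrite leq_mul2r; apply/orP; right; lia.
move: h; set p := ((2 * v).+1 ^ n)%N; lia.
Qed.

Lemma minr_le_dev (x y b e : R) : 0 <= b -> 0 <= y -> 0 <= e ->
  x <= 2 * y + 2 * e -> Num.min x b <= 2 * Num.min y b + 2 * e.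
Proof.
move=> b0 y0 e0 h; rewrite !minEle.
by case: (leP x b) => h1; case: (leP y b) => h2; lra.
Qed.

Lemma low_size_bound (w B l : R) : 1 <= w -> 1 <= B -> 1 <= 2 * l ->
  4 * (16 * B) * (2561 * w + 1) * l + 1 <= (500 * 400) * B * w * l.
Proof.
move=> w1 B1 l1.
have Bl : B <= B * (2 * l) by rewrite ler_peMr //; lra.
have h1 : B * l <= B * l * w by rewrite ler_peMr // mulr_ge0; lra.
rewrite (_ : 4 * _ * _ * _ = (64 * 2561) * (B * l * w) + 64 * (B * l)); last by ring.
rewrite (_ : 500 * 400 * _ * _ * _ = 500 * 400 * (B * l * w)); last by ring.
lra.
Qed.

Lemma high_size_bound (k w w' B l : R) : 1 <= k -> 1 <= w -> w' <= w ->
  1 <= B -> 1 <= 2 * l ->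
  128 * k * B * (256 * w * (4 * k + 10) + w') * l + 1 <=
  (1000 * 500) * (k + 1) ^+ 2 * B * w * l.
Proof.
move=> k1 w1 w'w B1 l1.
have Bl : B <= B * (2 * l) by rewrite ler_peMr //; lra.
have h1 : B * l <= B * l * w by rewrite ler_peMr // mulr_ge0; lra.
have W1 : 1 <= 2 * (B * l * w) by lra.
apply: (@le_trans _ _ (128 * k * B *
    (256 * w * (4 * k + 10) + w) * l + 1)).
  by rewrite lerD2r ler_wpM2r ?ler_wpM2l ?lerD2l // ?mulr_ge0 //; lra.
rewrite (_ : 128 * _ * _ * _ * _ = (128 * k * (1024 * k + 2561)) *
  (B * l * w)); last by ring.
rewrite (_ : 1000 * 500 * _ * _ * _ * _ = (1000 * 500 * (k + 1) ^+ 2) *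
  (B * l * w)); last by ring.
apply: (@le_trans _ _ ((128 * k * (1024 * k + 2561) + 2) * (B * l * w))).
  by rewrite [leRHS]mulrDl lerD2l.
by rewrite ler_wpM2r //; [lra|nra].
Qed.

Lemma pow4_gt0 i : 0 < 4 ^+ i :> R.
Proof. by rewrite exprn_gt0. Qed.

(** Fixes the length of the majority vote: with a = 2 L + 5 the failure probability 4^-a is small
    against the threshold of order 1 / (L 4^j) at level j. *)
Lemma pow4_bound (L j : nat) : (j < L)%N ->
  1280 * L%:R * 4 ^+ j < 4 ^+ (2 * L + 5) :> R.
Proof.
move=> jL; rewrite -!natrX -!natrM ltr_nat.
have h1 : (L < 4 ^ L)%N by exact: ltn_expl.
have h2 : (4 * 4 ^ j <= 4 ^ L)%N by rewrite -expnS leq_exp2l.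
have -> : (4 ^ (2 * L + 5) = 1024 * (4 ^ L * 4 ^ L))%N.
  by rewrite mulnC muln2 -addnn !expnD mulnC.
have : (L * (4 * 4 ^ j) <= 4 ^ L * 4 ^ L)%N by apply: leq_mul => //; exact: ltnW.
have : (0 < 4 ^ L * 4 ^ L)%N by rewrite muln_gt0 !expn_gt0.
clear; lia.
Qed.

Lemma majority_count (a b c d : nat) :
  (b + c = 2 * a -> b < a -> c <= d -> a < d)%N.
Proof. lia. Qed.

Section Levels.
Context (V : finType) (X : eqType) (h : V -> X -> bool -> R).
Variables (pts : seq (R * X)) (B : R) (L : nat).
Hypothesis pts_ge0 : nonneg_weights pts.
Hypothesis pts_one : fsum pts (fun=> 1) = 1.
Hypothesis B_ge1 : 1 <= B.
Hypothesis h_le : forall k x, sqn (h k x) <= B.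
Hypothesis h_L2 : forall k, fsum pts (fun x => sqn (h k x)) <= 2.
Hypothesis V_gt0 : (0 < #|V|)%N.

Let B_gt0 : 0 < B. Proof. exact: lt_le_trans ltr01 B_ge1. Qed.
Let B_neq0 : B != 0. Proof. by rewrite gt_eqF. Qed.
Local Notation rho := (2 ^+ L : R).
Let rho_gt0 : 0 < rho. Proof. by rewrite exprn_gt0. Qed.
Let rho_sq : rho ^+ 2 = 4 ^+ L.
Proof. by rewrite -exprM mulnC exprM; congr (_ ^+ _); rewrite expr2; lra. Qed.

Let logD : R := ln (2 * #|V|).+1%:R.
Let logD_ge : 1 <= 2 * logD. Proof. by apply: ln_nat_ge; lia. Qed.

Lemma spread_leB v x : \sum_k `|v k| <= rho -> spread h rho v x <= B.
Proof.
move=> vr; apply: (@le_trans _ _ (\sum_k `|v k| / rho * B)).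
  by apply: ler_sum => k _; rewrite ler_wpM2l // divr_ge0 // ltW.
rewrite -mulr_suml -[leRHS]mul1r ler_pM2r //.
exact: sum_weights_le1.
Qed.

(** Jensen's inequality for the random atom, whose mean times [rho] is [synth h v x]. *)
Lemma synth_le v x : \sum_k `|v k| <= rho ->
  sqn (synth h v x) <= rho ^+ 2 * spread h rho v x.
Proof.
move=> vr; have mm := maurey_mean_functional rho_gt0 vr.
rewrite -(maurey_mean_sqn h rho v x) /sqn meanD // mulrDr.
rewrite -!(maurey_mean_atom h v rho_gt0 x) -!meanZ //.
by apply: lerD; (apply: le_trans (mean_sqr_le _ mm) _;
  apply: mean_le => // d; rewrite exprMn).
Qed.

(** The spread combines the functions [sqn (h k)] with total weight at most 1; each of them
    contributes at most 2 under [pts] and at most 8 under the sample. *)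
Lemma spread_mean_le v t : \sum_k `|v k| <= rho -> (0 < size t)%N ->
  (forall k, \sum_(x <- t) sqn (h k x) <= 8 * (size t)%:R) ->
  fsum (pts ++ empirical R t) (spread h rho v) <= 10.
Proof.
move=> vr t0 ht; rewrite /spread fsum_sum.
apply: (@le_trans _ _ (\sum_k `|v k| / rho * 10)).
  apply: ler_sum => k _; rewrite fsumZ ler_wpM2l ?divr_ge0 ?(ltW rho_gt0) //.
  rewrite fsum_cat fsum_empirical /=; have := h_L2 k.
  have : (size t)%:R^-1 * \sum_(x <- t) sqn (h k x) <= 8.
    by rewrite mulrC ler_pdivrMr ?ltr0n.
  lra.
rewrite -mulr_suml -[leRHS]mul1r ler_pM2r //.
exact: sum_weights_le1.
Qed.

Lemma nu_ge0 t : nonneg_weights (pts ++ empirical R t).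
Proof.
rewrite /nonneg_weights all_cat; apply/andP; split; first exact: pts_ge0.
exact: empirical_ge0.
Qed.

Lemma chi01 k x : 0 <= sqn (h k x) / B <= 1.
Proof.
by rewrite divr_ge0 ?sqn_ge0 ?(ltW B_gt0) //= ler_pdivrMr // mul1r.
Qed.

Lemma chi_mean k : fsum pts (fun x => sqn (h k x) / B) <= 2 / B.
Proof.
rewrite (_ : (fun x => _) = (fun x => B^-1 * sqn (h k x))).
  by rewrite fsumZ mulrC ler_pM2r ?invr_gt0.
by apply/funext => x; rewrite mulrC.
Qed.

(** The additional tests [sqn (h k x) / B] have mean at most 2 / B and keep the empirical L2 norms
    of the dictionary bounded. Since theta <= 1 / B, the node count that serves the net also serves
    these tests. *)
Lemma sampling_points_dict (G : eqType) (net : seq G) (psi : G -> X -> R)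
    (theta : R) (n : nat) :
  (0 < n)%N -> size net = ((2 * #|V|).+1 ^ n)%N ->
  (forall g x, 0 <= psi g x <= 1) -> 0 < theta -> theta <= B^-1 ->
  exists t : seq X, [/\ (0 < size t)%N,
    (size t)%:R <= 4 / theta * n.+1%:R * logD + 1,
    forall g, g \in net -> theta <= fsum pts (psi g) ->
      (size t)%:R * theta / 4 <= \sum_(x <- t) psi g x
  & forall k, \sum_(x <- t) sqn (h k x) <= 8 * (size t)%:R].
Proof.
move=> n0 netE psi01 th0 thB.
have z0 : 0 < 4 / theta * n.+1%:R * logD.
  by rewrite !mulr_gt0 ?invr_gt0 //; have := logD_ge; lra.
have [m /andP[mge mle]] := ex_nat_ceil (ltW z0).
have [] := @sampling_points _ _ _ _ _ net psi (enum V)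
  (fun k x => sqn (h k x) / B) theta (2 / B) m
  (fsum_mean pts_ge0 pts_one) psi01 chi01 chi_mean.
- rewrite netE -cardE; have := ln_net_size V_gt0 n0; rewrite -/logD => hM.
  have : 4 / theta * n.+1%:R * logD * theta <= m%:R * theta by rewrite ler_pM2r.
  rewrite (_ : 4 / theta * n.+1%:R * logD * theta = 4 * (n.+1%:R * logD)).
    by lra.
  by field; rewrite gt_eqF.
- rewrite netE -cardE; have := ln_net_size V_gt0 n0; rewrite -/logD => hM.
  have : 4 / theta * n.+1%:R * logD * theta <= m%:R * theta by rewrite ler_pM2r.
  rewrite (_ : 4 / theta * n.+1%:R * logD * theta = 4 * (n.+1%:R * logD)).
    have : m%:R * theta <= m%:R * B^-1 by rewrite ler_wpM2l.
    have : 0 <= m%:R * B^-1 by rewrite mulr_ge0 // invr_ge0 ltW.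
    have := ln_ge0 (_ : 1 <= ((2 * #|V|).+1 ^ n + #|V|).+1%:R :> R).
    rewrite ler1n => /(_ isT); rewrite mulrCA; lra.
  by field; rewrite gt_eqF.
move=> t [tm tpsi tchi]; exists t; split.
- by rewrite tm -(ltr0n R); apply: lt_le_trans mge.
- by rewrite tm.
- by rewrite tm.
- move=> k; have := tchi k; rewrite mem_enum inE => /(_ isT).
  rewrite -mulr_suml ler_pdivrMr // tm.
  rewrite (_ : 4 * m%:R * (2 / B) * B = 8 * m%:R) //.
  by field.
Qed.

Lemma low_level : exists t : seq X,
  (size t)%:R <= (500 * 400) * B * 4 ^+ L * logD /\
  forall v, \sum_k `|v k| <= rho ->
    1 / 4 <= fsum pts (fun x => Num.min (sqn (synth h v x)) B) ->
    exists2 x, x \in t & 1 / 256 <= sqn (synth h v x).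
Proof.
(* The total spread is at most 10, so the expected error is at most 10 times 4^L / q, that is 10 /
   2561, just below 1 / 256. *)
pose q := (2561 * 4 ^ L)%N.
have q0 : (0 < q)%N by rewrite muln_gt0 expn_gt0.
pose g := avg_atoms h rho q.
pose psi s x := Num.min (sqn (g s x)) B / B.
have psi01 s x : 0 <= psi s x <= 1.
  rewrite divr_ge0 ?(ltW B_gt0) ?le_min ?sqn_ge0 ?(ltW B_gt0) //=.
  by rewrite ler_pdivrMr // mul1r ge_min lexx orbT.
have th0 : 0 < (16 * B)^-1 by rewrite invr_gt0 mulr_gt0.
have thB : (16 * B)^-1 <= B^-1.
  by rewrite lef_pV2 ?posrE ?mulr_gt0 //; have := B_gt0; lra.
have szW : size (words (atoms V) q) = ((2 * #|V|).+1 ^ q)%N.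
  by rewrite size_words size_atoms.
have [t [t0 tle tpsi tchi]] := sampling_points_dict q0 szW psi01 th0 thB.
exists t; split.
  apply: le_trans tle _; rewrite invrK.
  have e1 : 1 <= 4 ^+ L :> R by rewrite exprn_ege1 // ler1n.
  by rewrite -(@natr1 _ q) natrM natrX; apply: low_size_bound.
move=> v vr lowv.
set nu := pts ++ empirical R t.
pose err s x := sqn (fun e => g s x e - synth h v x e).
have mm := maurey_mean_functional rho_gt0 vr.
have mq := iterE_mean mm q.
have : iterE (maurey_mean rho v) q (fun s => fsum nu (err s)) < 1 / 256.
  rewrite mean_fsum //; apply: (@le_lt_trans _ _
    (fsum nu (fun x => rho ^+ 2 / q%:R * spread h rho v x))).
    by apply: fsum_le; [exact: nu_ge0|move=> x; exact: maurey_variance].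
  rewrite fsumZ rho_sq; have := spread_mean_le vr t0 tchi.
  rewrite -/nu => hs; apply: (@le_lt_trans _ _ (4 ^+ L / q%:R * 10)).
    by rewrite ler_wpM2l // divr_ge0 // exprn_ge0.
  rewrite /q natrM natrX.
  have : 4 ^+ L != 0 :> R by rewrite expf_neq0 // pnatr_eq0.
  move=> ne; rewrite (_ : _ * 10 = 10 / 2561); last by field.
  lra.
move=> /(@iterE_lt_ex _ _ _ xpredT)[].
  by move=> F c /(mean_lt_ex mm)[y]; exists y.
move=> s [sq _]; rewrite /nu fsum_cat => errlt.
have sW : s \in words (atoms V) q.
  by apply: mem_words => //; apply/allP => d _; rewrite /= mem_enum.
have err0 x : 0 <= err s x by exact: sqn_ge0.
have e1 : 0 <= fsum pts (err s) by apply: fsum_ge0.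
have e2 : 0 <= fsum (empirical R t) (err s).
  by apply: fsum_ge0 => //; exact: empirical_ge0.
have minle x : Num.min (sqn (synth h v x)) B <=
    (2 * B) * psi s x + 2 * err s x.
  have -> : (2 * B) * psi s x = 2 * Num.min (sqn (g s x)) B.
    by rewrite /psi; field.
  by apply: minr_le_dev; rewrite ?sqn_ge0 ?(ltW B_gt0) //; exact: sqn_le2.
have minle' x : Num.min (sqn (g s x)) B <=
    2 * Num.min (sqn (synth h v x)) B + 2 * err s x.
  apply: minr_le_dev; rewrite ?sqn_ge0 ?(ltW B_gt0) //.
  by rewrite /err sqnC; exact: sqn_le2.
(* The truncated values have mean at least 1/4 and the error costs less than 2/256, so 2 B times the
   mean of [psi s] is at least 1/8. *)
have big : (16 * B)^-1 <= fsum pts (psi s).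
  have := fsum_le pts_ge0 minle; rewrite fsumD !fsumZ => h1.
  rewrite -[leLHS]mul1r ler_pdivrMr ?mulr_gt0 //; lra.
have := tpsi _ sW big => hsum.
(* If the target were below 1/256 at every node, the truncated values of the net element would
   average less than 2/256 + 2/256 = 1/64 there, while its test guarantees B theta / 4 = 1/64. *)
apply: contrapT => nox.
have small x : x \in t -> Num.min (sqn (synth h v x)) B <= 1 / 256.
  move=> xt; rewrite ge_min; apply/orP; left; rewrite leNgt; apply/negP => xlt.
  by apply: nox; exists x => //; exact: ltW.
have sR : 0 < (size t)%:R :> R by rewrite ltr0n.
have h3 : \sum_(x <- t) Num.min (sqn (g s x)) B <=
    \sum_(x <- t) (2 / 256 + 2 * err s x).
  rewrite big_seq [leRHS]big_seq; apply: ler_sum => x xt.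
  by have := minle' x; have := small x xt; lra.
move: h3; rewrite big_split /= size_sum_cst -mulr_sumr.
have h4 : \sum_(x <- t) err s x < (size t)%:R * (1 / 256).
  rewrite mulrC -ltr_pdivrMr // mulrC -fsum_empirical; lra.
have : \sum_(x <- t) Num.min (sqn (g s x)) B = B * \sum_(x <- t) psi s x.
  by rewrite mulr_sumr; apply: eq_bigr => x _; rewrite /psi; field.
move=> ->.
have : B * ((size t)%:R * (16 * B)^-1 / 4) <= B * \sum_(x <- t) psi s x.
  by rewrite ler_pM2l.
rewrite (_ : B * _ = (size t)%:R / 64); last by field.
lra.
Qed.

Lemma high_level (j : nat) : (j < L)%N -> exists t : seq X,
  (size t)%:R <= (1000 * 500) * L.+1%:R ^+ 2 * B * 4 ^+ L * logD /\
  forall v, \sum_k `|v k| <= rho ->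
    (16 * L%:R * (B * 4 ^+ j))^-1 <=
      fsum pts (fun x => (B * 4 ^+ j < sqn (synth h v x))%R%:R) ->
    exists2 x, x \in t & 1 / 256 <= sqn (synth h v x).
Proof.
move=> jL; set Lam := B * 4 ^+ j.
have Lpos : (0 < L)%N by exact: leq_ltn_trans jL.
have L0 : 0 < L%:R :> R by rewrite ltr0n.
have Lam0 : 0 < Lam by rewrite mulr_gt0.
have Lam1 : 1 <= Lam by rewrite mulr_ege1 // exprn_ege1 // ler1n.
(* By Chebyshev, this makes one average deviate by more than Lam / 16 with probability at most
   spread / (16 B). *)
pose q := (256 * 4 ^ (L - j))%N.
have q0 : (0 < q)%N by rewrite muln_gt0 expn_gt0.
have qE : q%:R = 256 * 4 ^+ L / 4 ^+ j :> R.
  rewrite /q natrM natrX -mulrA; congr (_ * _).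
  by rewrite -{2}(subnK (ltnW jL)) exprD mulfK // gt_eqF.
(* A net element is a word of n = 2 a averages, which vote. *)
pose a := (2 * L + 5)%N; pose n := (2 * a)%N.
have qn0 : (0 < q * n)%N by rewrite muln_gt0 q0 /n /a muln_gt0 addn_gt0 orbT.
pose g := avg_atoms h rho q.
(* 7/16 = 1/2 - 1/16 is what [sqn_le2] leaves of a value above Lam after a deviation of at most Lam
   / 16. *)
pose strong x s := 7 / 16 * Lam <= sqn (g s x).
pose psi S x : R := (a < count (strong x) S)%N%:R.
have psi01 S x : 0 <= psi S x <= 1 by rewrite /psi ler0n lern1 leq_b1.
(* Half of the mass assumed at this level; the other half pays for the failed votes. *)
pose theta := (32 * L%:R * Lam)^-1.
have th0 : 0 < theta by rewrite invr_gt0 !mulr_gt0.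
have thB : theta <= B^-1.
  rewrite lef_pV2 ?posrE ?mulr_gt0 // -[leLHS]mul1r ler_pM ?(ltW B_gt0) //.
    by rewrite -natrM ler1n muln_gt0.
  by rewrite -[leLHS]mulr1 ler_pM2l // exprn_ege1 // ler1n.
have szW : size (words (words (atoms V) q) n) = ((2 * #|V|).+1 ^ (q * n))%N.
  by rewrite !size_words size_atoms expnM.
have [t [t0 tle tpsi tchi]] := sampling_points_dict qn0 szW psi01 th0 thB.
exists t; split.
  apply: le_trans tle _; rewrite invrK -(@natr1 _ (q * n)%N) natrM qE.
  have -> : n%:R = 4 * L%:R + 10 :> R.
    rewrite (_ : n = (4 * L + 10)%N); last by rewrite /n /a mulnDr mulnA.
    by rewrite (natrD _ (4 * L)%N) natrM.
  rewrite (_ : 4 * (32 * L%:R * Lam) * _ * _ = 128 * L%:R * B *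
    (256 * 4 ^+ L * (4 * L%:R + 10) + 4 ^+ j) * logD); last first.
    by rewrite /Lam; field; rewrite gt_eqF.
  have e0 : 4 ^+ j <= 4 ^+ L :> R by rewrite ler_weXn2l ?ler1n // ltnW.
  have e1 : 1 <= 4 ^+ L :> R by rewrite exprn_ege1 // ler1n.
  by rewrite -(@natr1 _ L); apply: high_size_bound; rewrite ?ler1n.
move=> v vr highv.
set nu := pts ++ empirical R t.
pose bad x s := Lam / 16 < sqn (fun e => g s x e - synth h v x e).
pose maj S x : R := (a <= count (bad x) S)%N%:R.
have mm := maurey_mean_functional rho_gt0 vr.
have mq := iterE_mean mm q.
have mqn := iterE_mean mq n.
pose r x := spread h rho v x / B.
have r01 x : 0 <= r x <= 1.
  by rewrite divr_ge0 ?spread_ge0 ?(ltW B_gt0) //= ler_pdivrMr // mul1r spread_leB.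
have Ebad x : iterE (maurey_mean rho v) q (fun s => (bad x s)%:R) <= r x / 16.
  have := maurey_variance h rho_gt0 vr x q0; rewrite rho_sq => hvar.
  apply: (@le_trans _ _ (iterE (maurey_mean rho v) q (fun s => 16 / Lam *
      sqn (fun e => g s x e - synth h v x e)))).
    apply: mean_le => // s; rewrite /bad; case: ltP => [lts|_].
      rewrite mulrAC ler_pdivlMr // mul1r.
      by move: lts; rewrite ltr_pdivrMr // mulrC; exact: ltW.
    by rewrite mulr_ge0 ?sqn_ge0 // divr_ge0 // ltW.
  rewrite meanZ //; apply: le_trans (ler_wpM2l _ hvar) _.
    by rewrite divr_ge0 // ltW.
  rewrite qE /r /Lam le_eqVlt; apply/orP; left; apply/eqP.
  by field; rewrite !gt_eqF.
(* The counting bound is (r / 4)^a. One factor [r] is kept and the others are bounded by 1, so that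
   integration brings in the mean of the spread together with a factor 1 / B. *)
have Emaj x : iterE (iterE (maurey_mean rho v) q) n (fun S => maj S x) <=
    4 ^- a * r x.
  have /andP[r0 r1] := r01 x.
  apply: le_trans (iterE_count_le mq n a (Ebad x) _) _.
    by rewrite divr_ge0.
  rewrite /n exprM -exprMn.
  rewrite (_ : 2 ^+ 2 * (r x / 16) = 4^-1 * r x); last by field.
  rewrite exprMn exprVn ler_wpM2l ?invr_ge0 ?(ltW (pow4_gt0 _)) //.
  by rewrite /a addnS exprS ler_piMr // exprn_ile1.
have big4 : 1280 * L%:R * 4 ^+ j < 4 ^+ a :> R by exact: pow4_bound.
have : iterE (iterE (maurey_mean rho v) q) n (fun S => fsum nu (maj S)) <
    theta / 4.
  rewrite mean_fsum //; apply: (@le_lt_trans _ _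
    (fsum nu (fun x => (4 ^- a / B) * spread h rho v x))).
    apply: fsum_le; first exact: nu_ge0.
    by move=> x; apply: le_trans (Emaj x) _; rewrite /r mulrA mulrAC.
  rewrite fsumZ; have := spread_mean_le vr t0 tchi; rewrite -/nu => hs.
  apply: (@le_lt_trans _ _ (4 ^- a / B * 10)).
    by rewrite ler_wpM2l // divr_ge0 ?(ltW B_gt0) // invr_ge0 ltW.
  rewrite (_ : 4 ^- a / B * 10 = 10 / (B * 4 ^+ a)); last first.
    by field; rewrite !gt_eqF.
  rewrite (_ : theta / 4 = 10 / (B * (1280 * L%:R * 4 ^+ j))); last first.
    by rewrite /theta /Lam; field; rewrite !gt_eqF.
  have A0 := pow4_gt0 a.
  have C0 : 0 < 1280 * L%:R * 4 ^+ j :> R.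
    exact: mulr_gt0 (mulr_gt0 (ltr0Sn _ _) L0) (pow4_gt0 j).
  rewrite ltr_pM2l; last by rewrite ltr0n.
  rewrite ltf_pV2.
  - by rewrite (ltr_pM2l B_gt0).
  - by rewrite posrE; exact: mulr_gt0 B_gt0 A0.
  - by rewrite posrE; exact: mulr_gt0 B_gt0 C0.
move=> /(@iterE_lt_ex _ _ _ (fun s => size s == q))[].
  move=> F c /(@iterE_lt_ex _ _ _ xpredT)[].
    by move=> F' c' /(mean_lt_ex mm)[y]; exists y.
  by move=> s [sq _]; exists s => //; apply/eqP.
move=> S [Sn Sq]; rewrite /nu fsum_cat => majlt.
have SW : S \in words (words (atoms V) q) n.
  apply: mem_words => //; apply: sub_all Sq => s /eqP sq; apply: mem_words => //.
  by apply/allP => d _; rewrite /= mem_enum.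
have e1 : 0 <= fsum pts (maj S) by apply: fsum_ge0 => // x; exact: ler0n.
have e2 : 0 <= fsum (empirical R t) (maj S).
  by apply: fsum_ge0; [exact: empirical_ge0|move=> x; exact: ler0n].
have level_le x : (Lam < sqn (synth h v x))%R%:R <= psi S x + maj S x.
  case: ltP => [lx|_]; last by rewrite addr_ge0 ?ler0n.
  rewrite /psi /maj -natrD ler1n; case: (leqP a (count (bad x) S)) => [|few].
    by rewrite addn1.
  rewrite addn0 lt0b.
  have := count_predC (bad x) S; rewrite Sn => cnt.
  have : (count (predC (bad x)) S <= count (strong x) S)%N.
    apply: sub_count => s /=; rewrite /bad /strong -leNgt => ls.
    have := sqn_le2 (synth h v x) (g s x); lra.
  exact: majority_count cnt few.
have big : theta <= fsum pts (psi S).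
  have := fsum_le pts_ge0 level_le; rewrite fsumD => h1.
  have h2 : (16 * L%:R * Lam)^-1 = 2 * theta.
    by rewrite /theta; field; rewrite !gt_eqF.
  by move: highv; rewrite -/Lam h2; lra.
have hsum := tpsi _ SW big.
have sR : 0 < (size t)%:R :> R by rewrite ltr0n.
(* Over the nodes, successful votes outnumber failed ones. At a node with more than [a] strong
   averages and fewer than [a] bad ones, some average is both strong and accurate, so the target is
   large there. *)
have [x xt hx] : exists2 x, x \in t & maj S x < psi S x.
  apply: contrapT => nox.
  have : \sum_(x <- t) psi S x <= \sum_(x <- t) maj S x.
    rewrite big_seq [leRHS]big_seq; apply: ler_sum => x xt.
    by rewrite leNgt; apply/negP => hx; apply: nox; exists x.
  have : \sum_(x <- t) maj S x < (size t)%:R * (theta / 4).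
    rewrite mulrC -ltr_pdivrMr // mulrC -fsum_empirical.
    by lra.
  by rewrite mulrA; lra.
exists x => //; move: hx; rewrite /psi /maj ltr_nat.
case: (ltnP a) => // many; case: (leqP a) => // few _.
have [s sS /andP[strs nbad]] : exists2 s, s \in S & strong x s && ~~ bad x s.
  apply: contrapT => nos.
  have : (count (strong x) S <= count (bad x) S)%N.
    rewrite (@eq_in_count _ _ (predI (strong x) (bad x))).
      by apply: sub_count => s /andP[].
    move=> s sS /=; case: (boolP (bad x s)) => b; rewrite ?andbT //.
    by case: (boolP (strong x s)) => // st; case: nos; exists s => //; apply/andP.
  by rewrite leqNgt (ltn_trans few many).
move: strs nbad; rewrite /strong /bad -leNgt => h1 h2.
have := sqn_le2 (g s x) (synth h v x); rewrite sqnC; lra.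
Qed.

End Levels.
End Core.

(** * Combining the levels *)

Section CorePoints.
Context (R : realType).

(** A layer decomposition: a value above B is at most 4 times the highest threshold that it
    exceeds. *)
Lemma min_layers_le (B u : R) (n : nat) : 0 < B -> 0 <= u -> u <= B * 4 ^+ n ->
  u <= Num.min u B + \sum_(j < n) 4 * (B * 4 ^+ j) * (B * 4 ^+ j < u)%R%:R.
Proof.
move=> B0 u0; elim: n => [|n IH].
  by rewrite expr0 mulr1 big_ord0 addr0 => /min_l ->.
move=> uB; rewrite big_ord_recr /=; case: (ltP (B * 4 ^+ n) u) => [_|/IH].
  rewrite mulr1 addrA; apply: (le_trans uB).
  rewrite exprS mulrCA lerDr addr_ge0 //; first by rewrite le_min u0 ltW.
  by apply: sumr_ge0 => j _; rewrite !mulr_ge0 ?(ltW B0) ?exprn_ge0.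
by rewrite mulr0 addr0.
Qed.

Section Points.
Context (V : finType) (X : eqType) (h : V -> X -> bool -> R).
Variables (pts : seq (R * X)) (B : R) (L : nat).
Hypothesis pts_ge0 : nonneg_weights pts.
Hypothesis pts_one : fsum pts (fun=> 1) = 1.
Hypothesis B_ge1 : 1 <= B.
Hypothesis h_le : forall k x, sqn (h k x) <= B.
Hypothesis h_L2 : forall k, fsum pts (fun x => sqn (h k x)) <= 2.
Hypothesis V_gt0 : (0 < #|V|)%N.

Let logD : R := ln (2 * #|V|).+1%:R.

Lemma high_levels (n : nat) : (n <= L)%N -> exists t : seq X,
  (size t)%:R <= n%:R * ((1000 * 500) * L.+1%:R ^+ 2 * B * 4 ^+ L * logD) /\
  forall v, \sum_k `|v k| <= 2 ^+ L -> forall j, (j < n)%N ->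
    (16 * L%:R * (B * 4 ^+ j))^-1 <=
      fsum pts (fun x => (B * 4 ^+ j < sqn (synth h v x))%R%:R) ->
    exists2 x, x \in t & 1 / 256 <= sqn (synth h v x).
Proof.
elim: n => [_|n IH nL]; first by exists [::]; rewrite mul0r; split.
have [t [tle tv]] := IH (ltnW nL).
have [t' [tle' tv']] := high_level pts_ge0 pts_one B_ge1 h_le h_L2 V_gt0 nL.
exists (t ++ t'); split.
  by rewrite size_cat natrD -(@natr1 _ n) mulrDl mul1r lerD.
move=> v vr j; rewrite ltnS leq_eqVlt => /predU1P[->|jn] hj.
  by have [x xt hx] := tv' v vr hj; exists x; rewrite // mem_cat xt orbT.
by have [x xt hx] := tv v vr j jn hj; exists x; rewrite // mem_cat xt.
Qed.

(** If the truncated part had mass below 1/4 and every level fell short of its threshold, the layers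
    would add at most L / (4 L) = 1/4, contradicting the total of 1/2. The levels below L suffice
    because [synth_le] bounds the values by B 4^L. *)
Lemma core_points : exists t : seq X,
  (size t)%:R <= (1000 * 700) * (B * 4 ^+ L * L.+1%:R ^+ 3 * logD) /\
  forall v, \sum_k `|v k| <= 2 ^+ L ->
    1 / 2 <= fsum pts (fun x => sqn (synth h v x)) ->
    exists2 x, x \in t & 1 / 256 <= sqn (synth h v x).
Proof.
have B0 : 0 < B by exact: lt_le_trans B_ge1.
have [t [tle tv]] := low_level L pts_ge0 pts_one B_ge1 h_le h_L2 V_gt0.
have [t' [tle' tv']] := high_levels (leqnn L).
exists (t ++ t'); split.
  rewrite size_cat natrD; apply: le_trans (lerD tle tle') _.
  have l0 : 0 <= logD by rewrite ln_ge0 // ler1n.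
  rewrite -/logD -(@natr1 _ L); set W := B * 4 ^+ L * logD.
  have W0 : 0 <= W by rewrite /W !mulr_ge0 ?(ltW B0) // exprn_ge0.
  rewrite (_ : 500 * 400 * _ * _ * _ + _ =
    (500 * 400 + 1000 * 500 * (L%:R * (L%:R + 1) ^+ 2)) * W); last first.
    by rewrite /W; ring.
  rewrite (_ : 1000 * 700 * _ = (1000 * 700 * (L%:R + 1) ^+ 3) * W); last first.
    by rewrite /W; ring.
  have L0 : 0 <= L%:R :> R by [].
  by rewrite ler_wpM2r //; move: L0; set k := L%:R => L0; clearbody k; nra.
move=> v vr half.
case: (lerP (1 / 4) (fsum pts (fun x => Num.min (sqn (synth h v x)) B))).
  by move=> /(tv v vr)[x xt hx]; exists x; rewrite // mem_cat xt.
move=> low_lt; apply: contrapT => nox.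
have few (j : 'I_L) :
    fsum pts (fun x => (B * 4 ^+ j < sqn (synth h v x))%R%:R) <
    (16 * L%:R * (B * 4 ^+ j))^-1.
  rewrite ltNge; apply/negP => /(tv' v vr j (ltn_ord j))[x xt hx].
  by apply: nox; exists x; rewrite // mem_cat xt orbT.
have layers x : sqn (synth h v x) <= Num.min (sqn (synth h v x)) B +
    \sum_(j < L) 4 * (B * 4 ^+ j) * (B * 4 ^+ j < sqn (synth h v x))%R%:R.
  apply: min_layers_le => //; first exact: sqn_ge0.
  apply: le_trans (synth_le h x vr) _.
  rewrite -exprM mulnC exprM (_ : 2 ^+ 2 = 4); last by rewrite expr2; lra.
  by rewrite mulrC ler_wpM2r ?exprn_ge0 // spread_leB.
have := fsum_le pts_ge0 layers; rewrite fsumD fsum_sum.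
under eq_bigr do rewrite fsumZ.
apply/negP; rewrite -ltNge; apply: lt_le_trans half.
suff : \sum_(j < L) 4 * (B * 4 ^+ j) *
    fsum pts (fun x => (B * 4 ^+ j < sqn (synth h v x))%R%:R) <= 1 / 4 by lra.
apply: (@le_trans _ _ (\sum_(j < L) (4 * L%:R)^-1)).
  apply: ler_sum => j _.
  have L0 : 0 < L%:R :> R by rewrite ltr0n (leq_ltn_trans _ (ltn_ord j)).
  have j0 : 0 < 4 * (B * 4 ^+ j) by rewrite !mulr_gt0 // exprn_gt0.
  apply: le_trans (_ : _ <= 4 * (B * 4 ^+ j) * (16 * L%:R * (B * 4 ^+ j))^-1) _.
    by rewrite (ler_pM2l j0) ltW.
  rewrite le_eqVlt; apply/orP; left; apply/eqP.
  by field; rewrite !gt_eqF // exprn_gt0.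
rewrite sumr_const card_ord -[leLHS]mulr_natl.
(* For L = 0 there are no layers, and the inverse of 0 is multiplied by 0. *)
case: (posnP L) => [->|L0]; first by rewrite mul0r divr_ge0.
rewrite invfM mulrCA mulfV ?mulr1 ?div1r //.
by rewrite pnatr_eq0 -lt0n.
Qed.

End Points.
End CorePoints.

(** * Finite quadrature *)

Section Quadrature.
Context (R : realType) (d : measure_display) (T : measurableType d)
  (mu : probability T R).

Lemma integrable_bounded (f : T -> R) (M : R) :
  measurable_fun setT f -> (forall x, `|f x| <= M) ->
  mu.-integrable setT (EFin \o f).
Proof.
move=> mf fM; apply: measurable_bounded_integrable => //.
  by rewrite ltey_eq fin_num_measure.
exists M; split; first exact: num_real.
by move=> M' MM' x _ /=; exact: le_trans (fM x) (ltW MM').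
Qed.

Lemma Rintegral_sum (J : Type) (r : seq J) (f : J -> T -> R) :
  (forall j, mu.-integrable setT (EFin \o f j)) ->
  Rintegral mu setT (fun x => \sum_(j <- r) f j x) =
  \sum_(j <- r) Rintegral mu setT (f j).
Proof.
move=> fi; elim: r => [|j r IH].
  rewrite big_nil; under eq_Rintegral do rewrite big_nil.
  by rewrite Rintegral_cst // mul0r.
under eq_Rintegral do rewrite big_cons.
rewrite big_cons RintegralD //; first by rewrite IH.
rewrite (_ : EFin \o _ = fun x => (\sum_(j <- r) (f j x)%:E)%E).
  by apply: integrable_sum => // i _; exact: fi.
by apply/funext => x /=; rewrite sumEFin.
Qed.

Lemma Rintegral_close (f g : T -> R) (eps : R) :
  mu.-integrable setT (EFin \o f) -> mu.-integrable setT (EFin \o g) ->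
  (forall x, `|f x - g x| <= eps) ->
  `|Rintegral mu setT f - Rintegral mu setT g| <= eps.
Proof.
move=> fi gi fg; have one : fine (mu setT) = 1 by rewrite probability_setT.
have ci : mu.-integrable setT (EFin \o cst eps).
  exact: finite_measure_integrable_cst.
have cE : Rintegral mu setT (cst eps) = eps.
  by rewrite Rintegral_cst // one mulr1.
rewrite ler_norml -RintegralB //.
have fgi : mu.-integrable setT (EFin \o (fun x => f x - g x)).
  by rewrite (_ : EFin \o _ = (EFin \o f) \- (EFin \o g))%E //; exact: integrableB.
apply/andP; split; last first.
  rewrite -[leRHS]cE; apply: le_Rintegral => // x _.
  exact: le_trans (ler_norm _) (fg x).
have ci' : mu.-integrable setT (EFin \o cst (- eps)).
  exact: finite_measure_integrable_cst.
rewrite -[leLHS]mulr1 -one -Rintegral_cst //; apply: le_Rintegral => // x _.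
by have := fg x; rewrite ler_norml => /andP[].
Qed.

(** Rounding the values to a grid of width eps cuts the space into finitely many measurable cells on
    which every function oscillates by at most eps. One point per cell, weighted by the measure of
    the cell, gives the rule. *)
Lemma quadrature (Q : finType) (f : Q -> T -> R) (M eps : R) :
  (forall r, measurable_fun setT (f r)) -> (forall r x, `|f r x| <= M) ->
  0 < eps ->
  exists pts : seq (R * T), [/\ nonneg_weights pts, fsum pts (fun=> 1) = 1 &
    forall r, `|fsum pts (f r) - Rintegral mu setT (f r)| <= eps].
Proof.
move=> mf fM eps0.
have [t0 _] : exists t0 : T, True.
  apply: contrapT => noT; have := @probability_setT _ _ _ mu.
  rewrite (_ : setT = set0) ?measure0; last first.
    by apply/seteqP; split=> // x _; case: noT; exists x.
  by move=> /eqP; rewrite eqe eq_sym oner_eq0.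
pose g r x := (f r x + M) / eps.
pose K := Num.truncn ((M + M) / eps).
pose phi x : {ffun Q -> 'I_K.+1} := [ffun r => inord (Num.truncn (g r x))].
have g_ge0 r x : 0 <= g r x.
  by rewrite divr_ge0 ?(ltW eps0) //; have := fM r x; rewrite ler_norml; lra.
have phiE r x : phi x r = Num.truncn (g r x) :> nat.
  rewrite ffunE inordK // ltnS truncn_le_nat; apply: le_lt_trans (truncnS_gt _).
  by rewrite ler_pM2r ?invr_gt0 // lerD2r (le_trans (ler_norm _)).
pose cell c := [set x | phi x = c].
have mcell c : measurable (cell c).
  rewrite (_ : cell c = \bigcap_(r in setT)
      (setT `&` g r @^-1` `[(c r)%:R, (c r).+1%:R[%classic)).
    apply: fin_bigcap_measurable; first exact: finite_finset.
    move=> r _; have mg : measurable_fun setT (g r); last exact: mg.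
    apply: measurable_funM; last exact: measurable_cst.
    by apply: measurable_funD => //; exact: measurable_cst.
  apply/seteqP; split=> [x <- r _|x hx].
    by split=> //=; rewrite in_itv /= phiE truncn_itv.
  apply/ffunP => r; apply: val_inj => /=; rewrite phiE.
  by have [_ /=] := hx r I; rewrite in_itv => /truncn_def.
(* The default [t0] stands in only for empty cells, whose weight is 0. *)
pose rep c := xget t0 (cell c).
have repP x : phi (rep (phi x)) = phi x.
  by apply: (@xgetPex _ t0 (cell (phi x))); exists x.
pose pts := [seq (fine (mu (cell c)), rep c) | c <- index_enum {ffun Q -> 'I_K.+1}].
have stepE F : (fun x => F (rep (phi x))) =
    (fun x => \sum_c F (rep c) * \1_(cell c) x : R).
  apply/funext => x; rewrite (bigD1 (phi x)) //= big1 => [|c cphi].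
    by rewrite addr0 indicE mem_set // mulr1.
  by rewrite indicE memNset ?mulr0 // => xc; case/eqP: cphi.
have iterm F c : mu.-integrable setT (EFin \o (fun x => F (rep c) * \1_(cell c) x)).
  rewrite (_ : EFin \o _ = (fun x => (F (rep c))%:E * (\1_(cell c) x)%:E)%E) //.
  by apply: integrableZl => //; exact: integrable_indic.
have istep F : mu.-integrable setT (EFin \o (fun x => F (rep (phi x)))).
  rewrite stepE (_ : EFin \o _ =
    fun x => (\sum_c (F (rep c) * \1_(cell c) x)%:E)%E).
    by apply: integrable_sum => // c _; exact: iterm.
  by apply/funext => x /=; rewrite sumEFin.
have Rstep F : Rintegral mu setT (fun x => F (rep (phi x))) = fsum pts F.
  rewrite stepE Rintegral_sum // /fsum big_map; apply: eq_bigr => c _ /=.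
  rewrite RintegralZl //; last exact: integrable_indic.
  by rewrite mulrC /Rintegral integral_indic // setIT.
exists pts; split.
- rewrite /nonneg_weights all_map; apply/allP => c _ /=.
  exact: fine_ge0.
- have one : fine (mu setT) = 1 by rewrite probability_setT.
  by rewrite -Rstep -[RHS]mulr1 -[X in _ = _ * X]one -Rintegral_cst.
move=> r; rewrite -Rstep; apply: Rintegral_close; first exact: istep.
  exact: integrable_bounded (mf r) (fM r).
move=> x; have := phiE r x; have := phiE r (rep (phi x)); rewrite repP => -> h.
have := truncn_itv (g_ge0 r x); have := truncn_itv (g_ge0 r (rep (phi x))).
rewrite h -(@natr1 _ (Num.truncn (g r x))).
set k := (Num.truncn _)%:R => /andP[h1 h2] /andP[h3 h4].
have : `|g r (rep (phi x)) - g r x| <= 1 by rewrite ler_norml; lra.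
rewrite /g -mulrBl normrM [X in _ * X]gtr0_norm ?invr_gt0 //.
by rewrite ler_pdivrMr // mul1r opprD addrACA subrr addr0.
Qed.

End Quadrature.

(** * Discretization for real coefficient vectors *)

Section RealDiscretization.
Context (R : realType) (d : measure_display) (T : measurableType d)
  (mu : probability T R).
Context (V : finType) (h : V -> T -> bool -> R) (B : R) (L : nat).

Definition hdot (k l : V) (x : T) : R :=
  h k x true * h l x true + h k x false * h l x false.

Hypothesis B_ge1 : 1 <= B.
Hypothesis h_meas : forall k e, measurable_fun setT (fun x => h k x e).
Hypothesis h_le : forall k x, sqn (h k x) <= B.
Hypothesis h_gram : forall k l,
  Rintegral mu setT (hdot k l) = (k == l)%:R.
Hypothesis V_gt0 : (0 < #|V|)%N.

(** Only finitely many products [hdot k l] occur, so one quadrature serves all [v] at once. *)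
Lemma sqn_synth (v : V -> R) x :
  sqn (synth h v x) = \sum_(p : V * V) v p.1 * v p.2 * hdot p.1 p.2 x.
Proof.
rewrite -(pair_bigA _ (fun k l => v k * v l * hdot k l x)) /=.
rewrite /sqn /synth !expr2 !mulr_suml -big_split; apply: eq_bigr => k _ /=.
rewrite !mulr_sumr -big_split; apply: eq_bigr => l _ /=.
by rewrite /hdot; ring.
Qed.

Lemma hdot_meas k l : measurable_fun setT (hdot k l).
Proof. by apply: measurable_funD; exact: measurable_funM. Qed.

Lemma hdot_le k l x : `|hdot k l x| <= B.
Proof.
have := h_le k x; have := h_le l x; rewrite ler_norml /hdot /sqn.
set a := h k x true; set b := h k x false; set c := h l x true.
set e := h l x false.
have := sqr_ge0 (a - c); have := sqr_ge0 (b - e).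
have := sqr_ge0 (a + c); have := sqr_ge0 (b + e).
move=> *; apply/andP; split; lra.
Qed.

(** Sparsity enters only as a comparison of the l1 and l2 norms. This condition is homogeneous, so
    [v] can be normalised in l2 before [core_points] is applied. *)
Lemma real_discretization : exists t : seq T,
  (size t)%:R <= (1000 * 700) * (B * 4 ^+ L * L.+1%:R ^+ 3 *
                                 ln (2 * #|V|).+1%:R) /\
  forall (v : V -> R) (eta : R), 0 <= eta ->
    (\sum_k `|v k|) ^+ 2 <= 4 ^+ L * \sum_k v k ^+ 2 ->
    (forall x, x \in t -> sqn (synth h v x) <= eta) ->
    \sum_k v k ^+ 2 <= 256 * eta.
Proof.
have W0 : 0 < 4 ^+ L :> R by exact: pow4_gt0.
have W1 : 1 <= 4 ^+ L :> R by rewrite exprn_ege1 // ler1n.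
(* An error eps in each Gram entry changes the quadratic form by at most eps times the squared l1
   norm, hence by at most 4^L eps = 1/2. *)
pose eps : R := (2 * 4 ^+ L)^-1.
have eps0 : 0 < eps by rewrite invr_gt0 mulr_gt0.
have eps1 : eps <= 1 by rewrite invf_le1 ?mulr_gt0 //; lra.
have [pts [pts0 pts1 ptsE]] := @quadrature _ _ _ mu _
  (fun p : V * V => hdot p.1 p.2) B eps (fun p => hdot_meas _ _)
  (fun p => hdot_le _ _) eps0.
have h_L2 k : fsum pts (fun x => sqn (h k x)) <= 2.
  have := ptsE (k, k); rewrite h_gram eqxx ler_norml /= => /andP[_].
  rewrite (_ : (fun x => _) = hdot k k); first lra.
  by apply/funext => x; rewrite /sqn /hdot !expr2.
have [t [tle tv]] := core_points L pts0 pts1 B_ge1 h_le h_L2 V_gt0.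
exists t; split=> // v eta eta0 v1 vt.
set s2 := \sum_k v k ^+ 2.
have s20 : 0 <= s2 by apply: sumr_ge0 => k _; exact: sqr_ge0.
have [->|s2n0] := eqVneq s2 0; first exact: mulr_ge0 (ler0n _ _) eta0.
have s2gt : 0 < s2 by rewrite lt_neqAle eq_sym s2n0.
pose s := Num.sqrt s2.
have s0 : 0 < s by rewrite sqrtr_gt0.
have ss : s ^+ 2 = s2 by rewrite sqr_sqrtr.
pose w k := s^-1 * v k.
have w2 : \sum_k w k ^+ 2 = 1.
  rewrite /w; under eq_bigr do rewrite exprMn.
  by rewrite -mulr_sumr exprVn ss mulVf.
have w1sq : (\sum_k `|w k|) ^+ 2 <= 4 ^+ L.
  rewrite /w; under eq_bigr do rewrite normrM (gtr0_norm (_ : 0 < s^-1)) ?invr_gt0 //.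
  by rewrite -mulr_sumr exprMn exprVn ss mulrC ler_pdivrMr.
have w1 : \sum_k `|w k| <= 2 ^+ L.
  rewrite -ler_sqr ?nnegrE ?sumr_ge0 ?exprn_ge0 // -exprM mulnC exprM.
  by rewrite (_ : 2 ^+ 2 = 4) // expr2; lra.
have half : 1 / 2 <= fsum pts (fun x => sqn (synth h w x)).
  have -> : fsum pts (fun x => sqn (synth h w x)) =
      \sum_(p : V * V) w p.1 * w p.2 * fsum pts (hdot p.1 p.2).
    under eq_bigr do rewrite -fsumZ.
    by rewrite -fsum_sum; congr fsum; apply/funext => x; exact: sqn_synth.
  have diag : \sum_(p : V * V) w p.1 * w p.2 * (p.1 == p.2)%:R = 1.
    rewrite -(pair_bigA _ (fun k l => w k * w l * (k == l)%:R)) /= -[RHS]w2.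
    apply: eq_bigr => k _; rewrite (bigD1 k) //= big1 => [|l lk].
      by rewrite eqxx mulr1 addr0 expr2.
    by rewrite eq_sym (negbTE lk) mulr0.
  suff : `|\sum_(p : V * V) w p.1 * w p.2 * fsum pts (hdot p.1 p.2) - 1| <= 1 / 2.
    by rewrite ler_norml => /andP[]; lra.
  rewrite -{1}diag -sumrB; apply: le_trans (ler_norm_sum _ _ _) _.
  apply: (@le_trans _ _ (\sum_(p : V * V) `|w p.1| * `|w p.2| * eps)).
    apply: ler_sum => p _; rewrite -mulrBr !normrM ler_wpM2l ?mulr_ge0 //.
    by have := ptsE p; rewrite h_gram.
  rewrite -mulr_suml -(pair_bigA _ (fun k l => `|w k| * `|w l|)) /=.
  under eq_bigr do rewrite -mulr_sumr.
  rewrite -mulr_suml -expr2 /eps ler_pdivrMr ?mulr_gt0 //.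
  by move: w1sq; set a := _ ^+ 2; set b := 4 ^+ L; lra.
have [x xt hx] := tv w w1 half.
have : sqn (synth h w x) = s2^-1 * sqn (synth h v x).
  have wv e : synth h w x e = s^-1 * synth h v x e.
    by rewrite /synth mulr_sumr; apply: eq_bigr => k _; rewrite /w mulrA.
  by rewrite /sqn !wv !exprMn exprVn ss -mulrDr.
move=> hw; have : 1 / 256 <= s2^-1 * eta.
  by apply: (le_trans hx); rewrite hw ler_pM2l ?invr_gt0 // vt.
by rewrite [leRHS]mulrC ler_pdivlMr //; lra.
Qed.

End RealDiscretization.

(** * Complex bounded orthonormal systems *)

Section ComplexModulus.
Context (R : realType).
Implicit Types z w : R[i].

Lemma cmod_ge0 z : 0 <= cmod z.
Proof. by case: z => a b; exact: sqrtr_ge0. Qed.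

Lemma cmod_sqr z : cmod z ^+ 2 = complex.Re z ^+ 2 + complex.Im z ^+ 2.
Proof. by case: z => a b /=; rewrite sqr_sqrtr // addr_ge0 ?sqr_ge0. Qed.

Lemma cmodM z w : cmod (z * w) = cmod z * cmod w.
Proof. exact: ComplexField.Normc.normcM. Qed.

Lemma cmodD z w : cmod (z + w) <= cmod z + cmod w.
Proof. exact: (le_normcD (z : Rcomplex R) w). Qed.

Lemma cmodN z : cmod (- z) = cmod z.
Proof. by case: z => a b; rewrite /cmod /= !sqrrN. Qed.

Lemma cmod_eq0 z : cmod z = 0 -> z = 0.
Proof. exact: ComplexField.Normc.eq0_normc. Qed.

Lemma cmodB_sqr z w : cmod (z - w) ^+ 2 <= 2 * cmod z ^+ 2 + 2 * cmod w ^+ 2.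
Proof.
rewrite !cmod_sqr; case: z => a b; case: w => c e /=.
by have := sqr_ge0 (a + c); have := sqr_ge0 (b + e); lra.
Qed.

End ComplexModulus.

Section LinfTheory.
Context (R : realType) d (T : measurableType d).
Implicit Types f g : Linf R T.

Lemma Linf_meas f : cmeasurable f.
Proof. by case: f => f /=; rewrite inE => -[]. Qed.

Lemma Linf_bounded f : exists M : R, forall x, cmod (f x) <= M.
Proof. by case: f => f /=; rewrite inE => -[]. Qed.

Lemma LinfD f g x : (f + g) x = f x + g x. Proof. by []. Qed.
Lemma LinfB f g x : (f - g) x = f x - g x. Proof. by []. Qed.
Lemma LinfZ a f x : (a *: f) x = a * f x. Proof. by []. Qed.
Lemma Linf0 x : (0 : Linf R T) x = 0. Proof. by []. Qed.

Lemma Linf_sum (J : Type) (r : seq J) (F : J -> Linf R T) x :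
  (\sum_(j <- r) F j) x = \sum_(j <- r) F j x.
Proof.
elim: r => [|j r IH]; first by rewrite !big_nil.
by rewrite !big_cons LinfD IH.
Qed.

Lemma sup_norm_leP f (a : R) :
  (sup_norm f <= a%:E)%E <-> forall x, cmod (f x) <= a.
Proof.
split=> [fa x|fa].
  rewrite -lee_fin; apply: le_trans fa; apply: ereal_sup_ubound.
  by exists x.
by apply: ge_ereal_sup => _ [x _ <-]; rewrite lee_fin.
Qed.

(** [op_norm] sees only the unit ball, so [f] is divided by [a], which therefore has to be
    positive. *)
Lemma op_norm_bound (P : {linear Linf R T -> Linf R T}) (tau a : R) f :
  (op_norm P <= tau%:E)%E -> 0 < a -> (forall x, cmod (f x) <= a) ->
  forall x, cmod (P f x) <= tau * a.
Proof.
move=> Pt a0 fa x; pose g := (a^-1)%:C%C *: f.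
have : (sup_norm (P g) <= tau%:E)%E.
  apply: le_trans Pt; apply: ereal_sup_ubound; exists g => //=.
  apply/sup_norm_leP => y; rewrite /g LinfZ cmodM.
  have -> : cmod (a^-1)%:C%C = a^-1.
    by rewrite /cmod /= expr0n /= addr0 sqrtr_sqr gtr0_norm ?invr_gt0.
  by rewrite mulrC ler_pdivrMr // mul1r.
move=> /sup_norm_leP /(_ x); rewrite /g linearZ LinfZ cmodM.
have -> : cmod (a^-1)%:C%C = a^-1.
  by rewrite /cmod /= expr0n /= addr0 sqrtr_sqr gtr0_norm ?invr_gt0.
by rewrite mulrC ler_pdivrMr.
Qed.

End LinfTheory.

(** Cauchy-Schwarz on the support, by expanding the sum of the squares of n |v k| - A. *)
Lemma sum_normr_sqr_le (R : realType) (V : finType) (v : V -> R) :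
  (\sum_k `|v k|) ^+ 2 <= #|[pred k | v k != 0]|%:R * \sum_k v k ^+ 2.
Proof.
set n := #|_|; set A := \sum_k `|v k|; set Q := \sum_k v k ^+ 2.
have AE : A = \sum_(k | v k != 0) `|v k|.
  rewrite /A [RHS]big_mkcond; apply: eq_bigr => k _.
  by case: eqP => //= ->; rewrite normr0.
have QE : Q = \sum_(k | v k != 0) v k ^+ 2.
  rewrite /Q [RHS]big_mkcond; apply: eq_bigr => k _.
  by case: eqP => //= ->; rewrite expr0n.
case: (posnP n) => [n0|n0].
  rewrite AE big_pred0 ?expr0n ?mulr_ge0 ?sumr_ge0 //.
    by move=> k _; exact: sqr_ge0.
  by move=> k; have := card0_eq n0 k; rewrite inE.
have : 0 <= \sum_(k | v k != 0) (n%:R * `|v k| - A) ^+ 2.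
  by apply: sumr_ge0 => k _; exact: sqr_ge0.
under eq_bigr do rewrite sqrrB exprMn real_normK ?num_real //.
rewrite big_split sumrB /= -mulr_sumr -QE sumr_const -/n.
have -> : \sum_(k | v k != 0) n%:R * `|v k| * A *+ 2 = n%:R * A ^+ 2 *+ 2.
  rewrite (eq_bigr (fun k => 2 * n%:R * A * `|v k|)); last by move=> k _; ring.
  by rewrite -mulr_sumr -AE; ring.
rewrite -[A ^+ 2 *+ n]mulr_natl (_ : _ + _ = n%:R * (n%:R * Q - A ^+ 2)); last by ring.
by rewrite pmulr_rge0 ?ltr0n // subr_ge0.
Qed.


Section ComplexDictionary.
Context (R : realType) (d : measure_display) (T : measurableType d)
  (mu : probability T R) (I : choiceType) (b : I -> Linf R T) (K : R).
Hypothesis bos : bounded_orthonormal_system mu K b.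

Lemma bos_le j x : cmod (b j x) <= K.
Proof. by have [_ /(_ j)] := bos; rewrite sup_norm_leP. Qed.

Variable A : {fset I}.

Definition lincomb (c : I -> R[i]) : Linf R T := \sum_(j <- A) c j *: b j.

(* [(j, false)] stands for b_j and [(j, true)] for i b_j; the outer boolean is
   [true] for the real part of the value and [false] for the imaginary part. *)
Definition real_dict (k : A * bool) (x : T) (e : bool) : R :=
  let z := b (val k.1) x in
  if k.2 then (if e then - complex.Im z else complex.Re z)
  else (if e then complex.Re z else complex.Im z).

Definition real_coef (c : I -> R[i]) (k : A * bool) : R :=
  if k.2 then complex.Im (c (val k.1)) else complex.Re (c (val k.1)).

Lemma big_real_dict (F : A * bool -> R) :
  \sum_k F k = \sum_(j : A) (F (j, false) + F (j, true)).
Proof.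
rewrite (eq_bigr (fun p => F (p.1, p.2))); last by case.
rewrite -(pair_bigA _ (fun j e => F (j, e))) /=; apply: eq_bigr => j _.
by rewrite big_bool addrC.
Qed.

Lemma lincombE c x :
  lincomb c x = \sum_(j : A) c (val j) * b (val j) x.
Proof. by rewrite /lincomb Linf_sum big_seq_fsetE. Qed.

Lemma sqn_lincomb c x :
  sqn (synth real_dict (real_coef c) x) = cmod (lincomb c x) ^+ 2.
Proof.
rewrite cmod_sqr lincombE !raddf_sum /sqn /synth !big_real_dict.
congr (_ ^+ 2 + _ ^+ 2); apply: eq_bigr => j _;
  rewrite /real_coef /real_dict /=;
  by case: (c _) => ? ?; case: (b _ _) => ? ? /=; ring.
Qed.

Lemma sum_real_coef c :
  \sum_k real_coef c k ^+ 2 = \sum_(j : A) cmod (c (val j)) ^+ 2.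
Proof.
by rewrite big_real_dict; apply: eq_bigr => j _; rewrite cmod_sqr.
Qed.

Lemma real_dict_meas k e : measurable_fun setT (fun x => real_dict k x e).
Proof.
case: k => j s; have [mr mi] := Linf_meas (b (val j)).
by case: s; case: e => //; exact: measurableT_comp mi.
Qed.

Lemma real_dict_sqn k x : sqn (real_dict k x) = cmod (b (val k.1) x) ^+ 2.
Proof. by case: k => j []; rewrite cmod_sqr /sqn /real_dict /=; ring. Qed.

Lemma real_dict_le k x : sqn (real_dict k x) <= K ^+ 2.
Proof.
rewrite real_dict_sqn; have h := bos_le (val k.1) x.
by rewrite ler_sqr ?nnegrE ?cmod_ge0 // (le_trans (cmod_ge0 _) h).
Qed.

(** Equal flags give the real part of b_i times the conjugate of b_j, mixed flags an imaginary part;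
    the order of the two indices absorbs its sign. *)
Lemma real_dict_gram k l :
  Rintegral mu setT (hdot real_dict k l) = (k == l)%:R.
Proof.
have [orth _] := bos.
have reE (i j : I) : Rintegral mu setT
    (fun x => complex.Re (b i x * conjc (b j x))) = (i == j)%:R.
  have := orth i j; rewrite /cintegral => /(congr1 (@complex.Re R)) /= ->.
  by case: eqP.
have imE (i j : I) : Rintegral mu setT
    (fun x => complex.Im (b i x * conjc (b j x))) = 0.
  have := orth i j; rewrite /cintegral => /(congr1 (@complex.Im R)) /= ->.
  by case: eqP.
case: k => i s; case: l => j s'.
rewrite -pair_eqE /pair_eq /= -val_eqE.
case: s; case: s'; rewrite ?andbT ?andbF.
- rewrite -reE; apply: eq_Rintegral => x _; rewrite /hdot /real_dict /=.
  by case: (b _ _) => ? ?; case: (b _ _) => ? ? /=; ring.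
- rewrite mulr0n -(imE (val j) (val i)); apply: eq_Rintegral => x _.
  rewrite /hdot /real_dict /=.
  by case: (b _ _) => ? ?; case: (b _ _) => ? ? /=; ring.
- rewrite mulr0n -(imE (val i) (val j)); apply: eq_Rintegral => x _.
  rewrite /hdot /real_dict /=.
  by case: (b _ _) => ? ?; case: (b _ _) => ? ? /=; ring.
- rewrite -reE; apply: eq_Rintegral => x _; rewrite /hdot /real_dict /=.
  by case: (b _ _) => ? ?; case: (b _ _) => ? ? /=; ring.
Qed.

Lemma hdot_integrable k l :
  mu.-integrable setT (EFin \o hdot real_dict k l).
Proof.
apply: integrable_bounded; first exact: hdot_meas real_dict_meas k l.
by move=> x; exact: hdot_le real_dict_le k l x.
Qed.

Lemma parseval c : Rintegral mu setT (fun x => cmod (lincomb c x) ^+ 2) =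
  \sum_(j : A) cmod (c (val j)) ^+ 2.
Proof.
rewrite -sum_real_coef.
rewrite (_ : (fun x => _) = fun x => \sum_(p : (A * bool) * (A * bool))
    real_coef c p.1 * real_coef c p.2 * hdot real_dict p.1 p.2 x); last first.
  by apply/funext => x; rewrite -sqn_lincomb sqn_synth.
rewrite Rintegral_sum => [|p]; last first.
  rewrite (_ : EFin \o _ = fun x => ((real_coef c p.1 * real_coef c p.2)%:E *
     (hdot real_dict p.1 p.2 x)%:E)%E) //.
  by apply: integrableZl => //; exact: hdot_integrable.
under eq_bigr do rewrite (RintegralZl _ _ (hdot_integrable _ _)) // real_dict_gram.
rewrite -(pair_bigA _
  (fun k l => real_coef c k * real_coef c l * (k == l)%:R)) /=.
apply: eq_bigr => k _; rewrite (bigD1 k) //= big1 => [|l lk].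
  by rewrite eqxx mulr1 addr0 expr2.
by rewrite eq_sym (negbTE lk) mulr0.
Qed.

(** A nonzero complex coefficient yields at most two nonzero real ones, hence the factor 2. *)
Lemma sum_real_coef_le c (s : nat) :
  (count (fun j => c j != 0%R) A <= s)%N ->
  (\sum_k `|real_coef c k|) ^+ 2 <=
  (2 * s)%:R * \sum_k real_coef c k ^+ 2.
Proof.
move=> cs; apply: le_trans (sum_normr_sqr_le _) _.
rewrite ler_wpM2r ?sumr_ge0 // => [k _|]; first exact: sqr_ge0.
rewrite ler_nat -sum1_card big_mkcond.
rewrite (eq_bigr (fun p => if real_coef c (p.1, p.2) != 0 then 1%N else 0%N));
  last by case.
rewrite -(pair_bigA _ (fun (j : A) (e : bool) =>
   if real_coef c (j, e) != 0 then 1%N else 0%N)) /=.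
apply: (@leq_trans (\sum_(j : A) 2 * (c (val j) != 0%R))%N).
  apply: leq_sum => j _; rewrite big_bool /real_coef /=.
  case: (c (val j)) => x y /=; rewrite eq_complex /= negb_and.
  by case: (x == 0); case: (y == 0).
rewrite -big_distrr leq_mul2l /=.
rewrite -(big_seq_fsetE _ _ predT (fun j => nat_of_bool (c j != 0))) /=.
apply: leq_trans cs; rewrite -sum1_count [leqRHS]big_mkcond.
by apply: leq_sum => j _; case: ifP.
Qed.

End ComplexDictionary.

(** The logarithms a and b of kappa + 1 and n + 1 are at least 1/2, so L + 1 <= a + b + 3 <= 16 a b,
    which separates [kappa] from [n]. The last factor uses 4 N + 1 <= (N + 1)^3. *)
Lemma log_factors_bound (R : realType) (kappa n N : nat) :
  (0 < kappa)%N -> (0 < n)%N -> (0 < N)%N ->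
  let L := (trunc_log 4 (kappa * n)).+2 in
  4 ^+ L * L.+1%:R ^+ 3 * ln (2 * (N * 2)).+1%:R <=
  (16 * 16 ^+ 3 * 3) * (kappa%:R * ln kappa.+1%:R ^+ 3 *
    (n%:R * ln n.+1%:R ^+ 3 * ln N.+1%:R)) :> R.
Proof.
move=> k0 n0 N0; set tr := trunc_log 4 (kappa * n) => /=.
have kn0 : (0 < kappa * n)%N by rewrite muln_gt0 k0.
have /andP[trle _] : (4 ^ tr <= kappa * n < 4 ^ tr.+1)%N.
  exact: trunc_log_bounds.
set a := ln kappa.+1%:R; set b := ln n.+1%:R.
have a2 : 1 <= 2 * a by apply: ln_nat_ge.
have b2 : 1 <= 2 * b by apply: ln_nat_ge.
have h4 : 4 ^+ tr.+2 <= 16 * (kappa%:R * n%:R) :> R.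
  rewrite -natrX -natrM -(natrM _ 16) ler_nat !expnS mulnA.
  by rewrite leq_mul2l trle.
have tr_ab : tr%:R <= a + b.
  have l4 : 1 <= 2 * ln (2%:R : R) by apply: ln_nat_ge.
  have l44 : ln (4%:R : R) = 2 * ln 2%:R.
    by rewrite (natrM _ 2 2) lnM ?posrE ?ltr0n //; ring.
  have : ln ((4 ^ tr)%:R : R) <= ln (kappa * n)%:R.
    by rewrite ler_ln ?posrE ?ltr0n ?expn_gt0 // ler_nat.
  rewrite natrX lnXn ?ltr0n // l44 -[_ *+ tr]mulr_natl.
  rewrite (natrM _ kappa) lnM ?posrE ?ltr0n // => h.
  have ka : ln (kappa%:R : R) <= a by rewrite ler_ln ?posrE ?ltr0n // ler_nat.
  have nb : ln (n%:R : R) <= b by rewrite ler_ln ?posrE ?ltr0n // ler_nat.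
  apply: (le_trans _ (lerD ka nb)); apply: (le_trans _ h).
  by rewrite ler_peMr.
have L_ab : tr.+3%:R <= 16 * (a * b).
  have ab : 1 <= 4 * (a * b).
    by rewrite (_ : 4 * (a * b) = (2 * a) * (2 * b)); [rewrite mulr_ege1|ring].
  have ab1 : 0 <= a * b by lra.
  have aab : a <= 2 * (a * b).
    by rewrite mulrCA ler_peMr //; lra.
  have bab : b <= 2 * (a * b).
    by rewrite mulrA ler_peMl //; lra.
  have -> : tr.+3%:R = tr%:R + 3 :> R by rewrite -natrD addn3.
  lra.
have lN : ln (2 * (N * 2)).+1%:R <= 3 * ln (N.+1%:R : R).
  rewrite mulr_natl -lnXn ?ltr0n // -natrX ler_ln ?posrE ?ltr0n ?expn_gt0 //.
  by rewrite ler_nat !expnS expn0 muln1; clear -N0; nia.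
have lN0 : 0 <= ln ((2 * (N * 2)).+1%:R : R) by rewrite ln_ge0 // ler1n.
apply: (@le_trans _ _ (16 * (kappa%:R * n%:R) * (16 * (a * b)) ^+ 3 *
   (3 * ln N.+1%:R))).
  have p0 : 0 <= 4 ^+ tr.+2 * tr.+3%:R ^+ 3 :> R.
    by rewrite mulr_ge0 ?exprn_ge0.
  apply: (ler_pM p0 lN0 _ lN); apply: ler_pM; rewrite ?exprn_ge0 //.
  by rewrite lerXn2r ?nnegrE //; exact: le_trans (ler0n _ _) L_ab.
by rewrite le_eqVlt; apply/orP; left; apply/eqP; ring.
Qed.

(** * Sparse functions in a bounded orthonormal system *)

Section SparseDiscretization.
Context (R : realType) (d : measure_display) (T : measurableType d)
  (mu : probability T R) (I : choiceType) (b : I -> Linf R T) (K : R).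
Hypothesis bos : bounded_orthonormal_system mu K b.

Lemma integrable_cmod_sqr (f : Linf R T) :
  mu.-integrable setT (EFin \o (fun x => cmod (f x) ^+ 2)).
Proof.
have [M fM] := Linf_bounded f; have [mr mi] := Linf_meas f.
apply: (@integrable_bounded _ _ _ _ _ (M ^+ 2)).
  rewrite (_ : (fun x => _) =
    (fun x => complex.Re (f x) ^+ 2 + complex.Im (f x) ^+ 2)).
    by apply: measurable_funD; exact: measurable_funX.
  by apply/funext => x; rewrite cmod_sqr.
move=> x; rewrite ger0_norm ?sqr_ge0 //.
by rewrite ler_sqr ?nnegrE ?cmod_ge0 // (le_trans (cmod_ge0 _) (fM x)).
Qed.

Lemma L2norm_le (f : Linf R T) (a : R) : 0 <= a ->
  Rintegral mu setT (fun x => cmod (f x) ^+ 2) <= a ^+ 2 ->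
  (L2norm mu f <= a%:E)%E.
Proof.
move=> a0 fa; rewrite /L2norm unlock.
rewrite (eq_integral (fun x => (cmod (f x) ^+ 2)%:E)); last first.
  move=> x _; rewrite /= ger0_norm ?cmod_ge0 //.
  by rewrite powR_mulrn ?cmod_ge0.
have fin := integrable_fin_num measurableT (integrable_cmod_sqr f).
rewrite -(fineK fin) poweR_EFin lee_fin powR12_sqrt; last first.
  by apply: fine_ge0; apply: integral_ge0 => x _; rewrite lee_fin sqr_ge0.
rewrite -ler_sqr ?nnegrE ?sqrtr_ge0 // sqr_sqrtr //.
by apply: Rintegral_ge0 => x _; exact: sqr_ge0.
Qed.

(** Some [b j0] has L2 norm 1, while its squared modulus is at most K^2 on a probability space. *)
Lemma K_sqr_ge1 (A : {fset I}) : A != fset0 -> 1 <= K ^+ 2.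
Proof.
move=> /fset0Pn[j0 j0A]; pose k : A * bool := ([` j0A]%fset, false).
have kk : Rintegral mu setT (hdot (real_dict b (A := A)) k k) = 1.
  by rewrite (real_dict_gram bos) eqxx.
rewrite -[leLHS]kk.
have one : fine (mu setT) = 1 by rewrite probability_setT.
rewrite -[leRHS]mulr1 -one -Rintegral_cst //; apply: le_Rintegral => //.
- exact: (hdot_integrable bos k k).
- exact: finite_measure_integrable_cst.
- move=> x _; apply: le_trans (real_dict_le bos k x).
  by rewrite /hdot /sqn !expr2.
Qed.

(** The sparsity is 2 s because differences of two s-sparse functions will be treated. It becomes 4
    s in real coordinates, and the two successors in [L] ensure 4 s <= 4^L. *)
Lemma sparse_discretization (A : {fset I}) (s : nat) :
  A != fset0 -> (0 < s)%N ->
  let L := (trunc_log 4 s).+2 in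
  exists t : seq T,
  (size t)%:R <= (1000 * 700) * (K ^+ 2 * 4 ^+ L * L.+1%:R ^+ 3 *
                                 ln (2 * (#|` A| * 2)).+1%:R) /\
  forall (c : I -> R[i]) (eta : R), 0 <= eta ->
    (count (fun j => c j != 0%R) A <= 2 * s)%N ->
    (forall x, x \in t -> cmod (lincomb b A c x) ^+ 2 <= eta) ->
    Rintegral mu setT (fun x => cmod (lincomb b A c x) ^+ 2) <= 256 * eta.
Proof.
move=> A0 s0 L.
have cardAb : #|{: A * bool}| = (#|` A| * 2)%N.
  by rewrite card_prod card_bool cardfE.
have A0' : (0 < #|{: A * bool}|)%N.
  by rewrite cardAb muln_gt0 cardfs_gt0 A0.
have [t] := @real_discretization R d T mu (A * bool)%type
  (real_dict b (A := A)) (K ^+ 2) L (K_sqr_ge1 A0) (@real_dict_meas _ _ _ _ b A)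
  (@real_dict_le _ _ _ _ _ _ _ bos A) (@real_dict_gram _ _ _ _ _ _ _ bos A) A0'.
rewrite cardAb => -[tle tv]; exists t; split=> // c eta eta0 cs small.
rewrite (parseval bos) -sum_real_coef; apply: tv => //.
  apply: le_trans (sum_real_coef_le cs) _.
  rewrite ler_wpM2r ?sumr_ge0 // => [k _|]; first exact: sqr_ge0.
  rewrite -natrX ler_nat mulnA /L expnS leq_mul2l /=.
  by have /andP[_ /ltnW] := trunc_log_bounds (isT : 1 < 4)%N s0.
by move=> x xt; rewrite sqn_lincomb; exact: small.
Qed.

Lemma lincomb_eq0 (A : {fset I}) c : lincomb b A c = 0 ->
  forall j, j \in A -> c j = 0.
Proof.
move=> c0 j jA; have := parseval bos A c; rewrite c0.
rewrite (_ : (fun x => _) = cst 0); last first.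
  by apply/funext => x; rewrite Linf0 cmod_sqr /= expr0n /= addr0.
rewrite Rintegral_cst // mul0r => /esym /eqP.
rewrite psumr_eq0 => [/allP|k _]; last exact: sqr_ge0.
move=> /(_ [` jA]%fset); rewrite mem_index_enum => /(_ isT) /=.
by rewrite sqrf_eq0 => /eqP /cmod_eq0.
Qed.

(** By linear independence on the union, the expansions over [J] and over [A] have the same
    coefficients, so those on [A] vanish outside [J]. *)
Lemma sparse_coef (A : {fset I}) (n : nat) g :
  Sigma b n g -> lin_span b A g ->
  exists c, g = lincomb b A c /\ (count (fun j => c j != 0%R) A <= n)%N.
Proof.
move=> [J Jn [c' _ gJ]] [c _ gA]; exists c; split; first by rewrite -gA.
pose e j : R[i] := (if j \in J then c' j else 0) - (if j \in A then c j else 0).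
have subE (B : {fset I}) a : (B `<=` J `|` A)%fset ->
    \sum_(j <- B) a j *: b j =
    \sum_(j <- (J `|` A)%fset) (if j \in B then a j else 0 : R[i]) *: b j.
  move=> BJA; rewrite -(big_fset_incl _ BJA) => [|j _ jB].
    by rewrite big_seq [RHS]big_seq; apply: eq_bigr => j ->.
  by rewrite (negbTE jB) scale0r.
have e0 : lincomb b (J `|` A)%fset e = 0.
  rewrite /lincomb; under eq_bigr do rewrite scalerBl.
  by rewrite sumrB -!subE ?fsubsetUl ?fsubsetUr // gJ gA subrr.
apply: leq_trans Jn; rewrite -size_filter; apply: uniq_leq_size.
  exact: filter_uniq.
move=> j; rewrite mem_filter => /andP[cj jA]; apply: contraNT cj => jJ.
have := lincomb_eq0 e0 (_ : j \in (J `|` A)%fset).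
rewrite /e jA in_fsetU jA orbT (negbTE jJ) sub0r => /(_ isT) /eqP.
by rewrite oppr_eq0.
Qed.

End SparseDiscretization.

(** * Recovery *)

Section Recovery.
Context (R : realType) (d : measure_display) (T : measurableType d)
  (mu : probability T R).

Lemma probability_inhabited : exists x : T, True.
Proof.
apply: contrapT => noT; have := @probability_setT _ _ _ mu.
rewrite (_ : setT = set0) ?measure0; last first.
  by apply/seteqP; split=> // x _; case: noT; exists x.
by move=> /eqP; rewrite eqe eq_sym oner_eq0.
Qed.

Lemma sup_norm_ge0 (f : Linf R T) : (0 <= sup_norm f)%E.
Proof.
have [x _] := probability_inhabited.
apply: (@le_trans _ _ (cmod (f x))%:E); first by rewrite lee_fin cmod_ge0.
by apply: ereal_sup_ubound; exists x.
Qed.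

Lemma L2norm_lt_pinfty (f : Linf R T) : (L2norm mu f < +oo)%E.
Proof.
have [M fM] := Linf_bounded f.
set r := Rintegral mu setT (fun x => cmod (f x) ^+ 2).
apply: (@le_lt_trans _ _ (1 + r)%:E); last exact: ltry.
have r0 : 0 <= r by apply: Rintegral_ge0 => x _; exact: sqr_ge0.
apply: L2norm_le; first by lra.
by rewrite -/r; nra.
Qed.

Lemma Linf_in_L2 (f : Linf R T) : in_L2 mu f.
Proof. by split; [exact: Linf_meas|exact: L2norm_lt_pinfty]. Qed.

Variables (I : choiceType) (b : I -> Linf R T) (K : R).
Hypothesis bos : bounded_orthonormal_system mu K b.

(* Products, since a large literal would be a large unary natural number. *)
Definition discretization_constant : R :=
  (1000 * 700) * (16 * 16 ^+ 3 * 3).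

Lemma discretization_constant_gt0 : 0 < discretization_constant.
Proof.
by rewrite /discretization_constant !pmulr_lgt0 ?exprn_gt0 ?ltr0n.
Qed.

(** The argument of the ceiling is nonnegative, so the absolute value only turns an integer into a
    natural number. *)
Definition sample_size (kappa n N : nat) : nat :=
  `|Num.ceil (discretization_constant * K ^+ 2 * kappa%:R *
      ln (kappa.+1)%:R ^+ 3 * n%:R * ln (n.+1)%:R ^+ 3 * ln (N.+1)%:R)|%N.

Lemma sampling_nodes (A : {fset I}) (kappa n : nat) : A != fset0 ->
  exists t : 'I_(sample_size kappa n #|` A|) -> T,
  forall (c : I -> R[i]) (eta : R), 0 <= eta ->
    (count (fun j => c j != 0%R) A <= 2 * (kappa * n))%N ->
    (forall i, cmod (lincomb b A c (t i)) <= eta) ->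
    Rintegral mu setT (fun x => cmod (lincomb b A c x) ^+ 2) <=
      256 * eta ^+ 2.
Proof.
move=> A0; have [x0 _] := probability_inhabited.
(* For kappa n = 0 the sample is empty, but then only the zero combination satisfies the sparsity
   bound. *)
have [/eqP|s0] := posnP (kappa * n).
  rewrite muln_eq0 => s0; exists (fun=> x0) => c eta eta0.
  rewrite (eqP (_ : kappa * n == 0)%N) ?muln_eq0 // muln0 leqn0 -leqn0.
  rewrite leqNgt -has_count => /hasPn cA _.
  rewrite (parseval bos) big1 => [|j _].
    exact: mulr_ge0 (ler0n _ _) (sqr_ge0 _).
  have /negPn/eqP -> := cA (val j) (valP j).
  by rewrite cmod_sqr /= expr0n /= addr0.
have [t [tle tv]] := sparse_discretization bos A0 s0.
have tm : (size t <= sample_size kappa n #|` A|)%N.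
  have [k0 n0] : (0 < kappa)%N /\ (0 < n)%N.
    by move: s0; rewrite muln_gt0 => /andP.
  have N0 : (0 < #|` A|)%N by rewrite cardfs_gt0.
  have c0 : 0 <= 1000 * 700 :> R by exact: mulr_ge0 (ler0n _ _) (ler0n _ _).
  have := ler_wpM2l c0 (ler_wpM2l (sqr_ge0 K)
    (log_factors_bound R k0 n0 N0)).
  rewrite [X in _ * X <= _](_ : _ = K ^+ 2 * 4 ^+ (trunc_log 4 (kappa * n)).+2 *
    (trunc_log 4 (kappa * n)).+3%:R ^+ 3 * ln (2 * (#|` A| * 2)).+1%:R);
    last by ring.
  move=> /(le_trans tle).
  rewrite (_ : 1000 * 700 * _ = discretization_constant * K ^+ 2 * kappa%:R *
      ln (kappa.+1)%:R ^+ 3 * n%:R * ln (n.+1)%:R ^+ 3 * ln (#|` A|.+1)%:R);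
    last by rewrite /discretization_constant; ring.
  rewrite /sample_size; set X := _ * ln _ => tX.
  rewrite -(ler_nat R) natr_absz ger0_norm.
    exact: le_trans tX (ceil_ge _).
  by rewrite ceil_ge0 (lt_le_trans (ltrN10 R)) // (le_trans _ tX).
(* Indices past the end of [t] are sent to [x0]; the surplus nodes only strengthen the assumption on
   [c]. *)
exists (fun i => nth x0 t i) => c eta eta0 cs small.
apply: tv => //; first exact: sqr_ge0.
move=> x xt; rewrite ler_sqr ?nnegrE ?cmod_ge0 //.
have it : (index x t < sample_size kappa n #|` A|)%N.
  by apply: leq_trans tm; rewrite index_mem.
by have := small (Ordinal it); rewrite /= nth_index.
Qed.

(** * Sparse approximation of the unit ball *)

Section Widths.
Variables (F : {pred Linf R T}) (q : Linf R T -> R).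

Lemma unit_ball0 : quasi_normed_space F q -> unit_ball F q 0.
Proof.
move=> [[F0 _] _ _ hom _]; split=> //.
have := hom 0 0 F0; rewrite scale0r => ->.
by rewrite (_ : cmod 0 = 0) ?mul0r // /cmod /= expr0n /= addr0 sqrtr0.
Qed.

(** Zero lies in the unit ball, so the supremum runs over a nonempty set and cannot be -oo. *)
Lemma worst_case_error_ge0 (G : set (Linf R T)) :
  quasi_normed_space F q -> (0 <= worst_case_error F q G)%E.
Proof.
move=> qns; apply: (@le_trans _ _
    (ereal_inf [set sup_norm (0 - g) | g in G])); last first.
  by apply: ereal_sup_ubound; exists 0 => //; exact: unit_ball0.
by apply: le_ereal_inf_tmp => _ [g _ <-]; exact: sup_norm_ge0.
Qed.

Lemma worst_case_error_approx (G : set (Linf R T)) (r a : R) f :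
  worst_case_error F q G = r%:E -> r < a -> unit_ball F q f ->
  exists2 g, G g & forall x, cmod (f x - g x) <= a.
Proof.
move=> wE ra fF.
have : (ereal_inf [set sup_norm (f - g)%R | g in G] < a%:E)%E.
  apply: (@le_lt_trans _ _ r%:E); last by rewrite lte_fin.
  by rewrite -wE; apply: ereal_sup_ubound; exists f.
move=> /ereal_inf_lt[_ [g Gg <-]] /ltW /sup_norm_leP h.
by exists g.
Qed.

(** Since P k = k, the error f - P g splits as (f - k) - P (f - k) + P (f - g). The slack [e] is
    there because the infima may not be attained. *)
Lemma sparse_approx (kappa n : nat) (J Jstar : {fset I}) (tau : R)
    (P : {linear Linf R T -> Linf R T}) (sr er e : R) f :
  quasi_projection b kappa n J Jstar tau P ->
  best_nterm_width b F q n = sr%:E -> best_linear_width b F q J = er%:E ->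
  0 <= sr -> 0 <= er -> 0 < e -> unit_ball F q f ->
  exists c, (count (fun j => c j != 0%R) Jstar <= kappa * n)%N /\
    forall x, cmod (f x - lincomb b Jstar c x) <=
      tau * (sr + e) + (1 + tau) * (er + e).
Proof.
move=> [tau0 Psig PJ PJs Ptau] sE eE sr0 er0 e0 fF.
have [g gsig fg] : exists2 g, Sigma b n g &
    forall x, cmod (f x - g x) <= sr + e.
  by apply: worst_case_error_approx sE _ fF; rewrite ltrDl.
have [k kJ fk] : exists2 g, lin_span b J g &
    forall x, cmod (f x - g x) <= er + e.
  by apply: worst_case_error_approx eE _ fF; rewrite ltrDl.
have [c [PgE cs]] := sparse_coef bos (Psig g gsig) (PJs g).
exists c; split=> // x; rewrite -PgE.
have -> : f x - P g x = (f x - k x) + - P (f - k) x + P (f - g) x.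
  rewrite (linearB P f g) (linearB P f k) (PJ k kJ) !LinfB.
  by ring.
have h1 : cmod (P (f - g) x) <= tau * (sr + e).
  by apply: (op_norm_bound Ptau); [rewrite ltr_wpDl|move=> y; exact: fg].
have h2 : cmod (P (f - k) x) <= tau * (er + e).
  by apply: (op_norm_bound Ptau); [rewrite ltr_wpDl|move=> y; exact: fk].
have := cmodD (f x - k x + - P (f - k) x) (P (f - g) x).
have := cmodD (f x - k x) (- P (f - k) x); rewrite cmodN.
by have := fk x; lra.
Qed.

End Widths.

(* Among the sparse functions matching the data up to [delta] at the nodes any
   choice is good: two of them differ by a sparse function that is small at the
   nodes, hence small in L2. *)
Lemma recovery_map (m : nat) (t : 'I_m -> T) (A : {fset I}) (s : nat)
    (delta : R) :
  0 <= delta ->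
  (forall (c : I -> R[i]) (eta : R), 0 <= eta ->
    (count (fun j => c j != 0%R) A <= 2 * s)%N ->
    (forall i, cmod (lincomb b A c (t i)) <= eta) ->
    Rintegral mu setT (fun x => cmod (lincomb b A c x) ^+ 2) <=
      256 * eta ^+ 2) ->
  exists rec : 'rV[R[i]]_m -> Linf R T, forall (f : Linf R T) c,
    (count (fun j => c j != 0%R) A <= s)%N ->
    (forall x, cmod (f x - lincomb b A c x) <= delta) ->
    (L2norm mu (fun x => (f x - rec (\row_i f (t i)) x)%R) <= (50 * delta)%R%:E)%E.
Proof.
move=> delta0 disc.
pose match_data (y : 'rV[R[i]]_m) (c : I -> R[i]) :=
  (count (fun j => c j != 0%R) A <= s)%N /\
  forall i, cmod (y ord0 i - lincomb b A c (t i)) <= delta.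
(* Data that no sparse combination matches get the zero coefficients; for [f] as in the conclusion,
   [c] itself is a match. *)
have choose_coef y : exists c, (exists c', match_data y c') -> match_data y c.
  have [[c' h]|no] := pselect (exists c', match_data y c'); first by exists c'.
  by exists (fun=> 0) => /no.
have [sol solP] := choice choose_coef.
exists (fun y => lincomb b A (sol y)) => f c cs fc.
set y := \row_i f (t i).
have [zs zy] : match_data y (sol y).
  apply: solP; exists c; split=> // i; rewrite mxE; exact: fc.
set z := sol y in zs zy *.
pose dif j := c j - z j.
have difE : lincomb b A dif = lincomb b A c - lincomb b A z.
  by rewrite /lincomb -sumrB; apply: eq_bigr => j _; rewrite scalerBl.
have difs : (count (fun j => dif j != 0%R) A <= 2 * s)%N.
  rewrite mul2n -addnn; apply: leq_trans (leq_add cs zs).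
  rewrite -count_predUI; apply: leq_trans (leq_addr _ _).
  apply: sub_count => j /=; rewrite /dif; apply: contraNT.
  by rewrite negb_or !negbK => /andP[/eqP -> /eqP ->]; rewrite subrr.
have small i : cmod (lincomb b A dif (t i)) <= 2 * delta.
  rewrite difE LinfB.
  have -> : lincomb b A c (t i) - lincomb b A z (t i) =
      (f (t i) - lincomb b A z (t i)) + - (f (t i) - lincomb b A c (t i)).
    by ring.
  apply: le_trans (cmodD _ _) _; rewrite cmodN.
  by have := fc (t i); have := zy i; rewrite mxE; lra.
have d2 : 0 <= 2 * delta by lra.
have := disc dif (2 * delta) d2 difs small => hdif.
rewrite (_ : (fun x => _) = (f - lincomb b A z : Linf R T)) //.
apply: L2norm_le; first by lra.
pose g := f - lincomb b A c.
(* After integration this gives 2 delta^2 + 512 (2 delta)^2 = 2050 delta^2, below (50 delta)^2. *)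
have sq x : cmod ((f - lincomb b A z) x) ^+ 2 <=
    2 * cmod (g x) ^+ 2 + 2 * cmod (lincomb b A dif x) ^+ 2.
  have -> : (f - lincomb b A z) x = g x - - lincomb b A dif x.
    by rewrite /g difE !LinfB; ring.
  by apply: le_trans (cmodB_sqr _ _) _; rewrite cmodN.
have i1 := integrable_cmod_sqr mu g.
have i2 := integrable_cmod_sqr mu (lincomb b A dif).
have scal (h : T -> R) : mu.-integrable setT (EFin \o h) ->
    mu.-integrable setT (EFin \o (fun x => 2 * h x)).
  move=> hi; rewrite (_ : EFin \o _ = fun x => (2%:E * (h x)%:E)%E) //.
  exact: integrableZl.
apply: (@le_trans _ _ (Rintegral mu setT (fun x =>
    2 * cmod (g x) ^+ 2 + 2 * cmod (lincomb b A dif x) ^+ 2))).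
  apply: le_Rintegral => //; first exact: integrable_cmod_sqr.
  rewrite (_ : EFin \o _ = ((EFin \o (fun x => 2 * cmod (g x) ^+ 2)%R) \+
    (EFin \o (fun x => 2 * cmod (lincomb b A dif x) ^+ 2)%R))%E) //.
  by apply: integrableD => //; exact: scal.
rewrite RintegralD //; [|exact: scal|exact: scal].
rewrite !RintegralZl //.
have gle : Rintegral mu setT (fun x => cmod (g x) ^+ 2) <= delta ^+ 2.
  have one : fine (mu setT) = 1 by rewrite probability_setT.
  rewrite -[leRHS]mulr1 -one -Rintegral_cst //; apply: le_Rintegral => //.
    exact: finite_measure_integrable_cst.
  by move=> x _; rewrite ler_sqr ?nnegrE ?cmod_ge0 //; exact: fc.
by nra.
Qed.

End Recovery.

Theorem corollary2p15 (R : realType) :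
  exists C Ct : R, [/\ 0 < C, 0 < Ct &
    forall (d : measure_display) (T : measurableType d) (mu : probability T R)
      (I : choiceType) (b : I -> Linf R T) (K : R)
      (F : {pred Linf R T}) (q : Linf R T -> R)
      (kappa n : nat) (J Jstar : {fset I})
      (P : {linear Linf R T -> Linf R T}) (tau : R),
    bounded_orthonormal_system mu K b ->
    quasi_normed_space F q ->
    compactly_embedded F q ->
    Jstar != fset0 ->
    quasi_projection b kappa n J Jstar tau P ->
    tau%:E = op_norm P ->
    let N := #|` Jstar| in
    let m := `|Num.ceil (C * K ^+ 2 * kappa%:R * ln (kappa.+1)%:R ^+ 3
                         * n%:R * ln (n.+1)%:R ^+ 3 * ln (N.+1)%:R)|%N in
    (sampling_number_L2 mu F q m <=
       Ct%:E * (op_norm P * best_nterm_width b F q n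
                + (1 + op_norm P) * best_linear_width b F q J))%E].
Proof.
exists (discretization_constant R), 50; split.
- exact: discretization_constant_gt0.
- by [].
move=> d T mu I b K F q kappa n J Jstar P tau bos qns _ Js0 qp tauE.
cbv zeta; rewrite -/(sample_size K kappa n #|` Jstar|).
set m := sample_size _ _ _ _.
have tau0 : 0 < tau by case: qp.
rewrite -tauE.
have s0 := worst_case_error_ge0 mu (Sigma b n) qns.
have e0 := worst_case_error_ge0 mu (lin_span b J) qns.
rewrite -/(best_nterm_width b F q n) in s0.
rewrite -/(best_linear_width b F q J) in e0.
(* Nonnegativity excludes -oo. If either width is +oo, so is the right-hand side, because tau >
   0. *)
case sE : (best_nterm_width b F q n) => [sr| |]; last by rewrite sE in s0.
- case eE : (best_linear_width b F q J) => [er| |]; last by rewrite eE in e0.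
  + rewrite sE lee_fin in s0; rewrite eE lee_fin in e0.
    rewrite [leRHS](_ : _ = (50 * (tau * sr + (1 + tau) * er))%:E) //.
    suff bound (eps : R) : 0 < eps -> (sampling_number_L2 mu F q m <=
        (50 * (tau * sr + (1 + tau) * er) + eps)%:E)%E.
      by apply/lee_addgt0Pr => eps eps0; rewrite -EFinD; exact: bound.
    (* Chosen so that 50 delta exceeds the desired bound by exactly eps. *)
    move=> eps0; pose e := eps / (50 * (1 + 2 * tau)).
    have D0 : 0 < 50 * (1 + 2 * tau) by lra.
    have e_gt0 : 0 < e by rewrite divr_gt0.
    pose delta := tau * (sr + e) + (1 + tau) * (er + e).
    have delta0 : 0 <= delta by rewrite addr_ge0 // mulr_ge0 //; lra.
    have [t tv] := sampling_nodes bos kappa n Js0.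
    have [rec recP] := recovery_map delta0 tv.
    have eE' : 50 * (1 + 2 * tau) * e = eps by rewrite mulrC divfK ?gt_eqF.
    have -> : 50 * (tau * sr + (1 + tau) * er) + eps = 50 * delta.
      by rewrite -eE' /delta; ring.
    apply: ge_ereal_inf; eexists; first by exists t.
    apply: ge_ereal_inf; eexists.
      exists (fun y => Linf_fun (rec y)) => // y; exact: Linf_in_L2.
    apply: ge_ereal_sup => _ [f fF <-].
    have [c [cs fc]] := sparse_approx bos qp sE eE s0 e0 e_gt0 fF.
    exact: recP cs fc.
  + rewrite sE lee_fin in s0; rewrite -EFinM -EFinD.
    rewrite gt0_muley ?lte_fin; last lra.
    by rewrite addey // gt0_muley ?lte_fin // leey.
- case eE : (best_linear_width b F q J) => [er| |]; last by rewrite eE in e0.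
  + rewrite gt0_muley ?lte_fin // -EFinD -EFinM addye // gt0_muley ?lte_fin //.
    by rewrite leey.
  + rewrite gt0_muley ?lte_fin // -EFinD gt0_muley ?lte_fin; last lra.
    by rewrite addye // gt0_muley ?lte_fin // leey.
Qed.
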